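(* Let $\ell_1,\ell_2,\ell_3 \subset \mathbb{C}$ be three parallel lines. Let $a > 0$ denote the distance between $\ell_1$ and $\ell_2$ and let $b > 0$ denote the distance between $\ell_2$ and $\ell_3$. Assume that $\tfrac{b}{a}$ is irrational and let $f$ and $g$ be entire functions. Then $|f| = |g|$ holds on $\ell_1 \cup \ell_2 \cup \ell_3$ if and only if $f \sim g$.
   Context: For entire functions $f,g : \mathbb{C} \to \mathbb{C}$, write $f \sim g$ if there exists $\alpha \in \mathbb{R}$ such that $f = e^{i\alpha} g$ (equality up to global phase). *)

(* Defs.v *)
From Stdlib Require Import Reals QArith Qreals.
From Coquelicot Require Import Coquelicot.

Open Scope R_scope.

(* Holomorphic on all of the complex plane; [ex_derive] is taken over the
   field [C], so the derivative is the complex one. *)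
Definition entire (f : C -> C) : Prop :=
  forall z : C, @ex_derive C_AbsRing C_NormedModule f z.

(* [L] is a line with direction vector [d].  Lines are parallel when they
   share a direction vector. *)
Definition is_line (d : C) (L : C -> Prop) : Prop :=
  d <> RtoC 0 /\
  exists p : C, forall z : C, L z <-> exists t : R, z = (p + RtoC t * d)%C.

Definition parallel (L M : C -> Prop) : Prop :=
  exists d : C, is_line d L /\ is_line d M.

Definition set_dist (A B : C -> Prop) : Rbar :=
  Glb_Rbar (fun r : R => exists z w : C, A z /\ B w /\ r = Cmod (z - w)%C).

Definition irrational (x : R) : Prop := ~ exists q : Q, x = Q2R q.

(* e^{i alpha}, by Euler's formula. *)
Definition cis (alpha : R) : C := (cos alpha, sin alpha).

Definition eq_up_to_phase (f g : C -> C) : Prop :=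
  exists alpha : R, forall z : C, f z = (cis alpha * g z)%C.

(* Main.v *)
Require Import Defs.
From Stdlib Require Import Reals QArith Qreals Lra Lia Classical.
From Coquelicot Require Import Coquelicot.
Local Open Scope R_scope.

(** After an affine change of variable the three lines become the horizontal
    lines Im = 0, A and B.  On the line Im w = c one has Cconj w = w - 2 i c, so
    with f* z := Cconj (f (Cconj z)) the equality |f| = |g| on that line reads
    f(w) f*(w - 2ic) = g(w) g*(w - 2ic); both sides are entire, so this holds
    for every complex w ([equal_modulus_reflection]).  The identities for
    c = 0 and c = A combine, after cancelling g, into
    f(z) g(z + 2iA) = g(z) f(z + 2iA): the quotient f/g has the period 2iA, and
    likewise 2iB ([ratio_period_of_lines]).  The real p for which i p is such
    a period form a group, which contains arbitrarily small positive
    elements because B/A is irrational ([small_elements]).  Hence, for a real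
    x0 with g(x0) <> 0, the entire function f(x0) g - g(x0) f has zeros
    accumulating at x0 and vanishes identically: f = c g with
    c = f(x0)/g(x0), and |c| = 1 because x0 lies on one of the lines
    ([uniqueness_horizontal]).

    This uses the identity theorem for functions that are merely assumed
    complex differentiable, and the cancellation law that follows from it;
    most of the file proves the identity theorem by integrating over triangles.
    Goursat's bisection argument gives the vanishing of triangle integrals
    ([Goursat]).  Cutting a small homothetic triangle out around z shows
    that (F(w) - F(z))/(w - z) also integrates to zero
    ([tri_int_removable]), which is a Cauchy formula
    int F(w)/(w - z) dw = F(z) k(z) ([Cauchy_formula]).  The factor
    k(z) = int dw/(w - z) does not vanish, since its imaginary part is a sum of
    integrals of positive functions ([tri_int_Cauchy_kernel_nz]).  Iterating the first step of the geometric
    expansion of 1/(w - z) gives Taylor remainders; zeros of F accumulating at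
    0 kill all Taylor coefficients, and the remainders tend to 0 on half of
    the disc ([zero_near_origin]).  As F is entire, the disc is as large as
    one likes, and F vanishes everywhere. *)

(** * Integrals of complex functions along segments *)

Local Notation CInt := (RInt (V := C_R_CompleteNormedModule)).

Definition path (p q : C) (t : R) : C := (p + RtoC t * (q - p))%C.

Definition seg_cont (H : C -> C) (p q : C) : Prop :=
  forall t, 0 <= t <= 1 ->
    continuous (T := R_UniformSpace) (U := C_UniformSpace) (fun s => H (path p q s)) t.

Definition seg_int (H : C -> C) (p q : C) : C :=
  ((q - p) * CInt (fun t => H (path p q t)) 0 1)%C.

(** The real normed space underlying [C] carries the product norm, which is
    not definitionally [Cmod]. *)
Lemma norm_C_R (z : C) : @norm R_AbsRing C_R_NormedModule z = Cmod z.
Proof.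
  unfold norm; simpl; unfold prod_norm, norm; simpl; unfold abs; simpl.
  unfold Cmod; f_equal; simpl.
  rewrite !Rmult_1_r, <- !Rabs_mult, !Rabs_pos_eq; try nra; ring.
Qed.

Lemma C_is_RInt_pair (h : R -> C) (a b : R) (l : C) :
  is_RInt (V := C_R_NormedModule) h a b l <->
  is_RInt (fun t => fst (h t)) a b (fst l) /\ is_RInt (fun t => snd (h t)) a b (snd l).
Proof.
  split.
  - intros H; split.
    + exact (is_RInt_fct_extend_fst (U := R_NormedModule) (V := R_NormedModule) h a b l H).
    + exact (is_RInt_fct_extend_snd (U := R_NormedModule) (V := R_NormedModule) h a b l H).
  - intros [H1 H2]; destruct l as [l1 l2].
    exact (is_RInt_fct_extend_pair (U := R_NormedModule) (V := R_NormedModule) h a b l1 l2 H1 H2).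
Qed.

(** The integral is real-linear by construction; complex linearity has to be
    checked on the two coordinates. *)
Lemma is_RInt_Cmult (c : C) (h : R -> C) (a b : R) (l : C) :
  is_RInt (V := C_R_NormedModule) h a b l ->
  is_RInt (V := C_R_NormedModule) (fun t => c * h t)%C a b (c * l)%C.
Proof.
  rewrite !C_is_RInt_pair; intros [H1 H2]; split; simpl.
  - apply (is_RInt_minus (V := R_NormedModule)); apply (is_RInt_scal (V := R_NormedModule)); assumption.
  - apply (is_RInt_plus (V := R_NormedModule)); apply (is_RInt_scal (V := R_NormedModule)); assumption.
Qed.

Lemma seg_ex_RInt H p q : seg_cont H p q ->
  ex_RInt (V := C_R_NormedModule) (fun t => H (path p q t)) 0 1.
Proof.
  intros Hc; apply (ex_RInt_continuous (V := C_R_CompleteNormedModule)).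
  rewrite Rmin_left, Rmax_right by lra; exact Hc.
Qed.

Lemma seg_int_correct H p q : seg_cont H p q ->
  is_RInt (V := C_R_NormedModule) (fun t => H (path p q t)) 0 1
    (CInt (fun t => H (path p q t)) 0 1).
Proof. intros Hc; apply (RInt_correct (V := C_R_CompleteNormedModule)), seg_ex_RInt, Hc. Qed.

Lemma seg_int_unique H p q l :
  is_RInt (V := C_R_NormedModule) (fun t => H (path p q t)) 0 1 l ->
  seg_int H p q = ((q - p) * l)%C.
Proof.
  intros Hl; unfold seg_int; f_equal.
  apply (is_RInt_unique (V := C_R_CompleteNormedModule)), Hl.
Qed.

Lemma seg_int_ext H G p q :
  (forall t, 0 < t < 1 -> H (path p q t) = G (path p q t)) -> seg_int H p q = seg_int G p q.
Proof.
  intros E; unfold seg_int; f_equal; apply RInt_ext.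
  rewrite Rmin_left, Rmax_right by lra; exact E.
Qed.

Lemma seg_int_linear c H G p q : seg_cont H p q -> seg_cont G p q ->
  seg_int (fun w => c * H w + G w)%C p q = (c * seg_int H p q + seg_int G p q)%C.
Proof.
  intros HH HG.
  assert (E := is_RInt_plus (V := C_R_NormedModule) _ _ _ _ _ _
    (is_RInt_Cmult c _ _ _ _ (seg_int_correct _ _ _ HH)) (seg_int_correct _ _ _ HG)).
  rewrite (seg_int_unique _ _ _ _ E); unfold seg_int, plus; simpl; unfold Cplus.
  change ((q - p) * (c * CInt (fun t => H (path p q t)) 0 1 + CInt (fun t => G (path p q t)) 0 1) =
   c * ((q - p) * CInt (fun t => H (path p q t)) 0 1) + (q - p) * CInt (fun t => G (path p q t)) 0 1)%C.
  ring.
Qed.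

Lemma seg_int_bound H p q M : seg_cont H p q ->
  (forall t, 0 <= t <= 1 -> Cmod (H (path p q t)) <= M) ->
  Cmod (seg_int H p q) <= Cmod (q - p) * M.
Proof.
  intros Hc HM; unfold seg_int; rewrite Cmod_mult.
  apply Rmult_le_compat_l; [apply Cmod_ge_0|].
  rewrite <- norm_C_R; replace M with ((1 - 0) * M) by ring.
  apply (norm_RInt_le_const (V := C_R_NormedModule) (fun t => H (path p q t))).
  - lra.
  - intros t Ht; rewrite norm_C_R; exact (HM t Ht).
  - apply seg_int_correct, Hc.
Qed.

Lemma seg_int_rev H p q : seg_cont H p q -> seg_int H q p = (- seg_int H p q)%C.
Proof.
  intros Hc.
  assert (E := is_RInt_comp_lin (V := C_R_NormedModule) (fun t => H (path p q t)) (-1) 1 0 1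
            (opp (CInt (fun t => H (path p q t)) 0 1))).
  assert (E' := E ltac:(replace (-1 * 0 + 1) with 1 by ring; replace (-1 * 1 + 1) with 0 by ring;
     apply (is_RInt_swap (V := C_R_NormedModule)),  seg_int_correct, Hc)).
  apply (is_RInt_opp (V := C_R_NormedModule)) in E'.
  rewrite (seg_int_unique H q p (CInt (fun t => H (path p q t)) 0 1)).
  - unfold seg_int; ring.
  - rewrite opp_opp in E'. revert E'; apply is_RInt_ext; intros t _.
    rewrite scal_R_Cmult.
    change (- (RtoC (-1) * H (path p q (-1 * t + 1))) = H (path q p t))%C.
    replace (path p q (-1 * t + 1)) with (path q p t).
    + ring.
    + unfold path; rewrite RtoC_plus, RtoC_mult; ring.
Qed.

Definition mid (p q : C) : C := ((p + q) / RtoC 2)%C.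

Lemma C2_nz : RtoC 2 <> RtoC 0.
Proof. intros E; apply RtoC_inj in E; lra. Qed.

Lemma seg_int_split H p q : seg_cont H p q ->
  seg_int H p q = (seg_int H p (mid p q) + seg_int H (mid p q) q)%C.
Proof.
  intros Hc.
  assert (Hex := seg_ex_RInt _ _ _ Hc).
  assert (H1 : ex_RInt (V := C_R_NormedModule) (fun t => H (path p q t)) 0 (1/2)).
  { apply (ex_RInt_Chasles_1 (V := C_R_CompleteNormedModule)) with (2 := Hex); lra. }
  assert (H2 : ex_RInt (V := C_R_NormedModule) (fun t => H (path p q t)) (1/2) 1).
  { apply (ex_RInt_Chasles_2 (V := C_R_CompleteNormedModule)) with (2 := Hex); lra. }
  assert (K1 := RInt_correct (V := C_R_CompleteNormedModule) _ _ _ H1).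
  assert (K2 := RInt_correct (V := C_R_CompleteNormedModule) _ _ _ H2).
  assert (E := RInt_Chasles (V := C_R_CompleteNormedModule) _ _ _ _ H1 H2).
  set (I1 := CInt _ 0 (1/2)) in *; set (I2 := CInt _ (1/2) 1) in *.
  assert (L1 := is_RInt_comp_lin (V := C_R_NormedModule) (fun t => H (path p q t)) (1/2) 0 0 1 I1
     ltac:(replace (1/2 * 0 + 0) with 0 by ring; replace (1/2 * 1 + 0) with (1/2) by ring; exact K1)).
  assert (L2 := is_RInt_comp_lin (V := C_R_NormedModule) (fun t => H (path p q t)) (1/2) (1/2) 0 1 I2
     ltac:(replace (1/2 * 0 + 1/2) with (1/2) by ring; replace (1/2 * 1 + 1/2) with 1 by field; exact K2)).
  apply (is_RInt_scal (V := C_R_NormedModule) _ _ _ 2) in L1.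
  apply (is_RInt_scal (V := C_R_NormedModule) _ _ _ 2) in L2.
  rewrite (seg_int_unique H p (mid p q) (2 * I1)%C), (seg_int_unique H (mid p q) q (2 * I2)%C).
  - unfold seg_int; rewrite <- E.
    change ((q - p) * (I1 + I2) = (mid p q - p) * (2 * I1) + (q - mid p q) * (2 * I2))%C.
    unfold mid; field; apply C2_nz.
  - rewrite <- scal_R_Cmult. revert L2; apply is_RInt_ext; intros t _.
    rewrite scal_assoc, scal_R_Cmult; unfold mult; simpl.
    replace (path p q (1/2 * t + 1/2)) with (path (mid p q) q t).
    + replace (2 * (1/2)) with 1 by field; apply Cmult_1_l.
    + unfold path, mid; rewrite RtoC_plus, RtoC_mult, RtoC_div; try lra; field; apply C2_nz.
  - rewrite <- scal_R_Cmult. revert L1; apply is_RInt_ext; intros t _.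
    rewrite scal_assoc, scal_R_Cmult; unfold mult; simpl.
    replace (path p q (1/2 * t + 0)) with (path p (mid p q) t).
    + replace (2 * (1/2)) with 1 by field; apply Cmult_1_l.
    + unfold path, mid; rewrite RtoC_plus, RtoC_mult, RtoC_div; try lra; field; apply C2_nz.
Qed.

Lemma seg_int_affine a b p q :
  seg_int (fun w => a + b * w)%C p q = (a * (q - p) + b * (q * q - p * p) / RtoC 2)%C.
Proof.
  assert (Ht : is_RInt (V := C_R_NormedModule) (fun t : R => RtoC t) 0 1 (RtoC (1/2))).
  { apply C_is_RInt_pair; simpl; split.
    - replace (1/2) with (minus (1*1/2) (0*0/2)) by (unfold minus, plus, opp; simpl; field).
      apply (is_RInt_derive (V := R_CompleteNormedModule) (fun t => t*t/2) (fun t => t)).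
      + intros; auto_derive; [easy|field].
      + intros; apply continuous_id.
    - assert (E := is_RInt_const (V := R_NormedModule) 0 1 0).
      rewrite (scal_zero_r (V := R_NormedModule)) in E; exact E. }
  assert (E := is_RInt_plus (V := C_R_NormedModule) _ _ _ _ _ _
     (is_RInt_const (V := C_R_NormedModule) 0 1 (a + b * p)%C)
     (is_RInt_Cmult (b * (q - p))%C _ _ _ _ Ht)).
  rewrite scal_R_Cmult in E.
  assert (E' : is_RInt (V := C_R_NormedModule) (fun t => a + b * path p q t)%C 0 1
    (RtoC (1 - 0) * (a + b * p) + (b * (q - p) * RtoC (1/2)))%C).
  { revert E; apply is_RInt_ext; intros t _.
    change ((a + b * p) + (b * (q - p)) * RtoC t = a + b * path p q t)%C. unfold path; ring. }
  rewrite (seg_int_unique _ _ _ _ E'), Rminus_0_r, RtoC_div by lra.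
  field; apply C2_nz.
Qed.

(** * Complex differentiability and Goursat's theorem for triangles *)

Definition holo (f : C -> C) (z : C) : Prop := @ex_derive C_AbsRing C_NormedModule f z.

(** Differentiability stated with [Cmod] alone, free of the two
    competing uniform structures on [C] (the one of the absolute value and the one of
    the product). *)
Definition deriv_at (f : C -> C) (z l : C) : Prop :=
  forall eps, 0 < eps -> exists delta, 0 < delta /\
    forall w, Cmod (w - z) < delta ->
      Cmod (f w - f z - (w - z) * l) <= eps * Cmod (w - z).

Lemma is_derive_deriv_at f z l :
  @is_derive C_AbsRing C_NormedModule f z l <-> deriv_at f z l.
Proof.
  split.
  - intros [_ H] eps Heps.
    destruct (H z (fun P HP => HP) (mkposreal eps Heps)) as [d Hd].
    exists d; split; [apply cond_pos|].
    intros w Hw; exact (Hd w Hw).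
  - intros H; split; [apply is_linear_scal_l|].
    intros x Hx; apply (is_filter_lim_locally_unique (V := AbsRing_NormedModule C_AbsRing)) in Hx; subst x.
    intros [eps Heps]; destruct (H eps Heps) as [d [Hd Hw]].
    exists (mkposreal d Hd); intros w Hwd; exact (Hw w Hwd).
Qed.

Lemma holo_deriv_at f z : holo f z <-> exists l, deriv_at f z l.
Proof. split; intros [l Hl]; exists l; apply is_derive_deriv_at; exact Hl. Qed.

(** [C] as a normed module and [C] as the normed module of its absolute value
    have the same norm and operations but are different structures; the product
    and chain rules are stated for the second one. *)
Lemma is_derive_C_AbsRing f z l :
  @is_derive C_AbsRing C_NormedModule f z l <->
  @is_derive C_AbsRing (AbsRing_NormedModule C_AbsRing) f z l.
Proof. split; intros [_ H]; (split; [apply is_linear_scal_l | exact H]). Qed.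

Lemma holo_const c z : holo (fun _ => c) z.
Proof. apply ex_derive_const. Qed.

Lemma holo_id z : holo (fun w => w) z.
Proof.
  apply holo_deriv_at; exists 1%C; intros eps Heps; exists 1; split; [lra|].
  intros w _; replace (w - z - (w - z) * 1)%C with (RtoC 0) by ring.
  rewrite Cmod_0; apply Rmult_le_pos; [lra | apply Cmod_ge_0].
Qed.

Lemma holo_plus f g z : holo f z -> holo g z -> holo (fun w => f w + g w)%C z.
Proof. exact (ex_derive_plus (V := C_NormedModule) f g z). Qed.

Lemma holo_minus f g z : holo f z -> holo g z -> holo (fun w => f w - g w)%C z.
Proof. exact (ex_derive_minus (V := C_NormedModule) f g z). Qed.

Lemma holo_mult f g z : holo f z -> holo g z -> holo (fun w => f w * g w)%C z.
Proof.
  intros [df Hf] [dg Hg]; eexists; apply is_derive_C_AbsRing.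
  apply (is_derive_mult (K := C_AbsRing) f g z df dg).
  - apply is_derive_C_AbsRing, Hf.
  - apply is_derive_C_AbsRing, Hg.
  - exact Cmult_comm.
Qed.

Lemma holo_comp f g z : holo f (g z) -> holo g z -> holo (fun w => f (g w)) z.
Proof.
  intros [df Hf] [dg Hg]; eexists.
  apply (is_derive_comp f g z df dg Hf), is_derive_C_AbsRing, Hg.
Qed.

Lemma Cmod_sub_triangle (a b c : C) : Cmod (a - c) <= Cmod (a - b) + Cmod (b - c).
Proof. replace (a - c)%C with ((a - b) + (b - c))%C by ring; apply Cmod_triangle. Qed.

Lemma Cmod_sub_sym (a b : C) : Cmod (a - b) = Cmod (b - a).
Proof. rewrite <- Cmod_opp; f_equal; ring. Qed.

Lemma holo_inv (z : C) : z <> RtoC 0 -> holo Cinv z.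
Proof.
  intros Hz; apply holo_deriv_at; exists (- / (z * z))%C; intros eps Heps.
  assert (Hm : 0 < Cmod z) by (apply Cmod_gt_0; exact Hz).
  exists (Rmin (Cmod z / 2) (eps * Cmod z ^ 3 / 2)); split.
  { apply Rmin_pos; [lra|]. assert (0 < Cmod z ^ 3) by (apply pow_lt; lra). nra. }
  intros w Hw.
  assert (H1 : Cmod (w - z) < Cmod z / 2) by (eapply Rlt_le_trans; [exact Hw | apply Rmin_l]).
  assert (H2 : Cmod (w - z) < eps * Cmod z ^ 3 / 2) by (eapply Rlt_le_trans; [exact Hw | apply Rmin_r]).
  assert (H3 : Cmod z / 2 < Cmod w).
  { assert (T := Cmod_sub_triangle z w 0).
    replace (z - 0)%C with z in T by ring; replace (w - 0)%C with w in T by ring.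
    rewrite (Cmod_sub_sym z w) in T; lra. }
  assert (Hw0 : w <> RtoC 0) by (apply Cmod_gt_0; lra).
  replace (/ w - / z - (w - z) * (- / (z * z)))%C with ((w - z) * (w - z) / (w * (z * z)))%C
    by (field; split; assumption).
  assert (Hzz : (w * (z * z))%C <> RtoC 0) by (repeat apply Cmult_neq_0; assumption).
  rewrite Cmod_div, !Cmod_mult by exact Hzz.
  apply Rle_div_l; [repeat apply Rmult_lt_0_compat; lra|].
  assert (Hp := Cmod_ge_0 (w - z)).
  replace (eps * Cmod (w - z) * (Cmod w * (Cmod z * Cmod z)))
    with (Cmod (w - z) * (eps * (Cmod z * Cmod z) * Cmod w)) by ring.
  apply Rmult_le_compat_l; [exact Hp|].
  apply Rle_trans with (eps * Cmod z ^ 3 / 2); [lra|].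
  replace (eps * Cmod z ^ 3 / 2) with (eps * (Cmod z * Cmod z) * (Cmod z / 2)) by field.
  apply Rmult_le_compat_l; [|lra].
  apply Rmult_le_pos; [lra|nra].
Qed.

Lemma holo_pow f n z : holo f z -> holo (fun w => f w ^ n)%C z.
Proof.
  intros Hf; induction n as [|n IH]; simpl; [apply holo_const | apply holo_mult; assumption].
Qed.

Lemma holo_continuous f z : holo f z ->
  continuous (T := C_UniformSpace) (U := C_UniformSpace) f z.
Proof.
  intros H; apply ex_derive_continuous in H.
  intros P HP; apply locally_C, H, HP.
Qed.

Lemma path_continuous p q t :
  continuous (T := R_UniformSpace) (U := C_UniformSpace) (path p q) t.
Proof.
  apply (continuous_ext (T := R_UniformSpace) (U := C_UniformSpace)
    (fun s : R => @plus C_R_NormedModule p (@scal R_AbsRing C_R_NormedModule s (q - p)%C))).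
  - intros s; unfold path; rewrite scal_R_Cmult; reflexivity.
  - apply (continuous_plus (K := R_AbsRing) (V := C_R_NormedModule)).
    + apply continuous_const.
    + apply (continuous_scal_l (K := R_AbsRing) (V := C_R_NormedModule)), continuous_id.
Qed.

Lemma holo_seg_cont H p q :
  (forall t, 0 <= t <= 1 -> holo H (path p q t)) -> seg_cont H p q.
Proof.
  intros Hh t Ht.
  apply (continuous_comp (path p q) H); [apply path_continuous | apply holo_continuous, Hh, Ht].
Qed.

Definition tri_int (H : C -> C) (a b c : C) : C := (seg_int H a b + seg_int H b c + seg_int H c a)%C.

(** The domains on which Goursat's theorem is proved: bisection needs the
    segments between points of D to stay in D, and so must the limit point of
    the nested triangles.  The half-planes that avoid a given point are of this
    kind. *)
Record convex_closed (D : C -> Prop) : Prop := {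
  cc_path : forall p q t, D p -> D q -> 0 <= t <= 1 -> D (path p q t);
  cc_closed : closed (T := C_UniformSpace) D }.

Lemma mid_path p q : mid p q = path p q (1/2).
Proof. unfold mid, path; rewrite RtoC_div by lra; field; apply C2_nz. Qed.

(** The three inner sides are run through twice in opposite directions. *)
Lemma tri_int_split H a b c : seg_cont H a b -> seg_cont H b c -> seg_cont H c a ->
  seg_cont H (mid a b) (mid b c) -> seg_cont H (mid b c) (mid c a) ->
  seg_cont H (mid c a) (mid a b) ->
  tri_int H a b c = (tri_int H a (mid a b) (mid c a) + tri_int H (mid a b) b (mid b c) +
     tri_int H (mid c a) (mid b c) c + tri_int H (mid a b) (mid b c) (mid c a))%C.
Proof.
  intros H1 H2 H3 H4 H5 H6; unfold tri_int.
  rewrite (seg_int_split H a b), (seg_int_split H b c), (seg_int_split H c a) by assumption.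
  rewrite (seg_int_rev H (mid a b) (mid b c)), (seg_int_rev H (mid b c) (mid c a)),
    (seg_int_rev H (mid c a) (mid a b)) by assumption.
  ring.
Qed.

Record triangle : Set := Triangle { va : C; vb : C; vc : C }.

Definition triangle_int H (T : triangle) : C := tri_int H (va T) (vb T) (vc T).

Definition corner_a T := Triangle (va T) (mid (va T) (vb T)) (mid (vc T) (va T)).
Definition corner_b T := Triangle (mid (va T) (vb T)) (vb T) (mid (vb T) (vc T)).
Definition corner_c T := Triangle (mid (vc T) (va T)) (mid (vb T) (vc T)) (vc T).
Definition medial T := Triangle (mid (va T) (vb T)) (mid (vb T) (vc T)) (mid (vc T) (va T)).

(** Choosing the first quarter that carries at least a fourth of the integral
    makes the bisection the iteration of a function.  The
    medial triangle is the default: it qualifies if the three others do not. *)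
Definition worst_quarter (H : C -> C) (T : triangle) : triangle :=
  let big T' := Rle_dec (Cmod (triangle_int H T)) (4 * Cmod (triangle_int H T')) in
  if big (corner_a T) then corner_a T else
  if big (corner_b T) then corner_b T else
  if big (corner_c T) then corner_c T else medial T.

Definition inD (D : C -> Prop) T := D (va T) /\ D (vb T) /\ D (vc T).

Definition size_le (d : R) T :=
  Cmod (vb T - va T) <= d /\ Cmod (vc T - vb T) <= d /\ Cmod (va T - vc T) <= d.

Lemma worst_quarter_cases (P : triangle -> Prop) H T :
  P (corner_a T) -> P (corner_b T) -> P (corner_c T) -> P (medial T) ->
  P (worst_quarter H T).
Proof.
  intros; unfold worst_quarter.
  repeat (destruct Rle_dec; [assumption|]); assumption.
Qed.

Lemma inD_seg_cont D H p q : convex_closed D -> (forall w, D w -> holo H w) ->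
  D p -> D q -> seg_cont H p q.
Proof. intros HD Hh Hp Hq; apply holo_seg_cont; intros t Ht; apply Hh, (cc_path D HD); assumption. Qed.

Lemma inD_mid D p q : convex_closed D -> D p -> D q -> D (mid p q).
Proof. intros HD Hp Hq; rewrite mid_path; apply (cc_path D HD); trivial; lra. Qed.

Lemma worst_quarter_inD D H T : convex_closed D -> inD D T -> inD D (worst_quarter H T).
Proof.
  intros HD (Ha & Hb & Hc).
  apply worst_quarter_cases; repeat split; simpl; try assumption; apply inD_mid; assumption.
Qed.

Lemma worst_quarter_big D H T : convex_closed D -> (forall w, D w -> holo H w) -> inD D T ->
  Cmod (triangle_int H T) <= 4 * Cmod (triangle_int H (worst_quarter H T)).
Proof.
  intros HD Hh (Ha & Hb & Hc); unfold worst_quarter.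
  destruct Rle_dec as [Q1|Q1]; [exact Q1|].
  destruct Rle_dec as [Q2|Q2]; [exact Q2|].
  destruct Rle_dec as [Q3|Q3]; [exact Q3|].
  assert (E : triangle_int H T = (triangle_int H (corner_a T) + triangle_int H (corner_b T)
    + triangle_int H (corner_c T)
    + triangle_int H (medial T))%C).
  { apply tri_int_split; apply (inD_seg_cont D H); trivial; apply inD_mid; trivial. }
  assert (T1 := Cmod_triangle
    (triangle_int H (corner_a T) + triangle_int H (corner_b T) + triangle_int H (corner_c T))
    (triangle_int H (medial T))).
  assert (T2 := Cmod_triangle (triangle_int H (corner_a T) + triangle_int H (corner_b T))
    (triangle_int H (corner_c T))).
  assert (T3 := Cmod_triangle (triangle_int H (corner_a T)) (triangle_int H (corner_b T))).
  rewrite <- E in T1; lra.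
Qed.

Lemma Cmod_half (z : C) : Cmod (z / RtoC 2) = Cmod z / 2.
Proof. rewrite Cmod_div by apply C2_nz; rewrite Cmod_R, Rabs_pos_eq by lra; reflexivity. Qed.

Lemma Cmod_halved (d : R) (p q x y : C) :
  (p - q = (x - y) / RtoC 2)%C -> Cmod (x - y) <= d -> Cmod (p - q) <= d / 2.
Proof. intros -> Hd; rewrite Cmod_half; lra. Qed.

Lemma worst_quarter_size H d T : size_le d T -> size_le (d / 2) (worst_quarter H T).
Proof.
  intros (H1 & H2 & H3).
  assert (Half : forall p q x y : C, (p - q = (x - y) / RtoC 2)%C ->
    Cmod (x - y) <= d \/ Cmod (y - x) <= d -> Cmod (p - q) <= d / 2).
  { intros p q x y E [Hd|Hd]; apply (Cmod_halved d p q x y E);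
      [exact Hd | rewrite Cmod_sub_sym; exact Hd]. }
  apply worst_quarter_cases; repeat split; simpl;
    first
    [ apply (Half _ _ (va T) (vb T)); [unfold mid; field; apply C2_nz | tauto]
    | apply (Half _ _ (vb T) (va T)); [unfold mid; field; apply C2_nz | tauto]
    | apply (Half _ _ (vb T) (vc T)); [unfold mid; field; apply C2_nz | tauto]
    | apply (Half _ _ (vc T) (vb T)); [unfold mid; field; apply C2_nz | tauto]
    | apply (Half _ _ (vc T) (va T)); [unfold mid; field; apply C2_nz | tauto]
    | apply (Half _ _ (va T) (vc T)); [unfold mid; field; apply C2_nz | tauto] ].
Qed.

(** This makes the first vertices of the nested triangles a Cauchy sequence. *)
Lemma worst_quarter_step H d T : size_le d T -> Cmod (va (worst_quarter H T) - va T) <= d.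
Proof.
  intros (H1 & H2 & H3).
  assert (H0 : 0 <= d) by (eapply Rle_trans; [apply Cmod_ge_0 | exact H1]).
  apply worst_quarter_cases; simpl.
  - replace (va T - va T)%C with (RtoC 0) by ring; rewrite Cmod_0; exact H0.
  - replace (mid (va T) (vb T) - va T)%C with ((vb T - va T) / RtoC 2)%C
      by (unfold mid; field; apply C2_nz). rewrite Cmod_half; lra.
  - replace (mid (vc T) (va T) - va T)%C with (- ((va T - vc T) / RtoC 2))%C
      by (unfold mid; field; apply C2_nz). rewrite Cmod_opp, Cmod_half; lra.
  - replace (mid (va T) (vb T) - va T)%C with ((vb T - va T) / RtoC 2)%C
      by (unfold mid; field; apply C2_nz). rewrite Cmod_half; lra.
Qed.

Lemma dyadic_small (K e : R) : 0 <= K -> 0 < e -> exists n, K / 2 ^ n < e.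
Proof.
  intros HK He.
  destruct (pow_lt_1_zero (1/2) ltac:(rewrite Rabs_pos_eq; lra) (e / (K + 1))) as [n Hn].
  { apply Rdiv_lt_0_compat; lra. }
  exists n; specialize (Hn n (le_n n)).
  assert (H2 : 0 < / 2 ^ n) by (apply Rinv_0_lt_compat, pow_lt; lra).
  replace ((1/2) ^ n) with (/ 2 ^ n) in Hn by (rewrite <- pow_inv; f_equal; field).
  rewrite Rabs_pos_eq in Hn by lra.
  apply Rlt_div_r in Hn; [unfold Rdiv; nra | lra].
Qed.

(** The intervals of centre u n and radius 2 K / 2^n are nested, so the
    supremum of their left ends lies in all of them. *)
Lemma geometric_Cauchy_R (u : nat -> R) K :
  (forall n, Rabs (u (S n) - u n) <= K / 2 ^ n) ->
  exists l, forall n, Rabs (u n - l) <= 2 * K / 2 ^ n.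
Proof.
  intros Hu.
  assert (Hp : forall n, 0 < 2 ^ n) by (intros; apply pow_lt; lra).
  assert (Hs : forall n, K / 2 ^ n = 2 * (K / 2 ^ S n)).
  { intros n; simpl; field. apply Rgt_not_eq, Hp. }
  assert (Hs' : forall n, 2 * K / 2 ^ n = 2 * (K / 2 ^ n)).
  { intros n; field. apply Rgt_not_eq, Hp. }
  set (lo n := u n - 2 * (K / 2 ^ n)); set (hi n := u n + 2 * (K / 2 ^ n)).
  assert (Hlo : forall n m, lo n <= lo (n + m)%nat).
  { intros n m; induction m as [|m IH]; [rewrite Nat.add_0_r; apply Rle_refl|].
    eapply Rle_trans; [exact IH|]; rewrite Nat.add_succ_r; unfold lo.
    generalize (Hu (n + m)%nat) (Hs (n + m)%nat); intros A B; apply Rabs_le_between in A; lra. }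
  assert (Hhi : forall n m, hi (n + m)%nat <= hi n).
  { intros n m; induction m as [|m IH]; [rewrite Nat.add_0_r; apply Rle_refl|].
    eapply Rle_trans; [|exact IH]; rewrite Nat.add_succ_r; unfold hi.
    generalize (Hu (n + m)%nat) (Hs (n + m)%nat); intros A B; apply Rabs_le_between in A; lra. }
  assert (HK : forall n, 0 <= K / 2 ^ n).
  { intros n; eapply Rle_trans; [apply Rabs_pos | apply Hu]. }
  assert (Hlh : forall n m, lo n <= hi m).
  { intros n m; apply Rle_trans with (lo (n + m)%nat); [apply Hlo|].
    apply Rle_trans with (hi (n + m)%nat); [unfold lo, hi; specialize (HK (n + m)%nat); lra|].
    rewrite Nat.add_comm; apply Hhi. }
  destruct (completeness (fun x => exists n, x = lo n)) as [l [Hl1 Hl2]].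
  - exists (hi O); intros x [n ->]; apply Hlh.
  - exists (lo O), O; reflexivity.
  - exists l; intros n; rewrite Hs'; apply Rabs_le_between.
    assert (A := Hl1 (lo n) (ex_intro _ n eq_refl)).
    assert (B : l <= hi n) by (apply Hl2; intros x [m ->]; apply Hlh).
    unfold lo, hi in *; lra.
Qed.

Lemma Cmod_le_parts (z : C) M : Rabs (fst z) <= M -> Rabs (snd z) <= M -> Cmod z <= 2 * M.
Proof.
  intros H1 H2.
  replace z with (RtoC (fst z) + Ci * RtoC (snd z))%C
    by (destruct z; unfold Ci, RtoC, Cplus, Cmult; simpl; f_equal; ring).
  eapply Rle_trans; [apply Cmod_triangle|].
  rewrite Cmod_mult, Cmod_Ci, !Cmod_R; lra.
Qed.

Lemma fst_le_Cmod (z : C) : Rabs (fst z) <= Cmod z.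
Proof. eapply Rle_trans; [apply Rmax_l | apply Rmax_Cmod]. Qed.

Lemma snd_le_Cmod (z : C) : Rabs (snd z) <= Cmod z.
Proof. eapply Rle_trans; [apply Rmax_r | apply Rmax_Cmod]. Qed.

Lemma geometric_Cauchy (u : nat -> C) K :
  (forall n, Cmod (u (S n) - u n) <= K / 2 ^ n) ->
  exists l, forall n, Cmod (u n - l) <= 4 * K / 2 ^ n.
Proof.
  intros Hu.
  destruct (geometric_Cauchy_R (fun n => fst (u n)) K) as [x Hx].
  { intros n; eapply Rle_trans; [|apply Hu].
    exact (fst_le_Cmod (u (S n) - u n)). }
  destruct (geometric_Cauchy_R (fun n => snd (u n)) K) as [y Hy].
  { intros n; eapply Rle_trans; [|apply Hu].
    exact (snd_le_Cmod (u (S n) - u n)). }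
  exists (x, y); intros n.
  replace (4 * K / 2 ^ n) with (2 * (2 * K / 2 ^ n)) by (unfold Rdiv; ring).
  apply Cmod_le_parts; [apply Hx | apply Hy].
Qed.

Lemma closed_seq_limit (D : C -> Prop) (u : nat -> C) p K :
  closed (T := C_UniformSpace) D -> (forall n, D (u n)) ->
  (forall n, Cmod (u n - p) <= K / 2 ^ n) -> D p.
Proof.
  intros HD Hu Hp; apply HD; intros Hn.
  apply locally_C in Hn; destruct Hn as [d Hd].
  assert (HK : 0 <= K).
  { generalize (Hp O) (Cmod_ge_0 (u O - p)); simpl; lra. }
  destruct (dyadic_small K d HK (cond_pos d)) as [n Hn].
  apply (Hd (u n)); [|apply Hu].
  exact (Rle_lt_trans _ _ _ (Hp n) Hn).
Qed.

Lemma path_near p q z rho t : Cmod (p - z) <= rho -> Cmod (q - z) <= rho -> 0 <= t <= 1 ->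
  Cmod (path p q t - z) <= rho.
Proof.
  intros Hp Hq Ht.
  replace (path p q t - z)%C with (RtoC (1 - t) * (p - z) + RtoC t * (q - z))%C
    by (unfold path; rewrite RtoC_minus; ring).
  eapply Rle_trans; [apply Cmod_triangle|].
  rewrite !Cmod_mult, !Cmod_R, !Rabs_pos_eq by lra; nra.
Qed.

(** Bisection: the integral over the n-th triangle is at least 4^-n times the
    initial one, while differentiability at the limit point p makes it
    o(4^-n), the affine part of H at p having zero integral over any triangle. *)
Lemma Goursat D H a b c : convex_closed D -> (forall w, D w -> holo H w) ->
  D a -> D b -> D c -> tri_int H a b c = RtoC 0.
Proof.
  intros HD Hh Ha Hb Hc.
  set (T := Triangle a b c).
  assert (HT : inD D T) by (repeat split; assumption).
  change (triangle_int H T = RtoC 0).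
  set (d := Cmod (vb T - va T) + Cmod (vc T - vb T) + Cmod (va T - vc T)).
  assert (Hd0 : 0 <= d).
  { unfold d; generalize (Cmod_ge_0 (vb T - va T)) (Cmod_ge_0 (vc T - vb T))
      (Cmod_ge_0 (va T - vc T)); lra. }
  assert (Hd : size_le d T).
  { unfold size_le, d; generalize (Cmod_ge_0 (vb T - va T)) (Cmod_ge_0 (vc T - vb T))
      (Cmod_ge_0 (va T - vc T)); lra. }
  set (t n := Nat.iter n (worst_quarter H) T).
  assert (tD : forall n, inD D (t n)).
  { intros n; induction n as [|n IH]; [exact HT | apply worst_quarter_inD; assumption]. }
  assert (tS : forall n, size_le (d / 2 ^ n) (t n)).
  { intros n; induction n as [|n IH]; [replace (d / 2 ^ 0) with d by (simpl; field); exact Hd|].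
    replace (d / 2 ^ S n) with (d / 2 ^ n / 2) by (simpl; field; apply pow_nonzero; lra).
    apply worst_quarter_size; assumption. }
  assert (tB : forall n, Cmod (triangle_int H T) <= 4 ^ n * Cmod (triangle_int H (t n))).
  { intros n; induction n as [|n IH]; [simpl; lra|].
    assert (Q := worst_quarter_big D H (t n) HD Hh (tD n)).
    assert (0 < 4 ^ n) by (apply pow_lt; lra).
    change (t (S n)) with (worst_quarter H (t n)); simpl; nra. }
  destruct (geometric_Cauchy (fun n => va (t n)) d) as [p Hp].
  { intros n; apply worst_quarter_step, tS. }
  assert (Dp : D p).
  { apply (closed_seq_limit D (fun n => va (t n)) p (4 * d)); [apply HD | intros n; apply tD | exact Hp]. }
  destruct (proj1 (holo_deriv_at H p) (Hh p Dp)) as [l Hl].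
  apply Cmod_eq_0, Rle_antisym; [|apply Cmod_ge_0].
  apply le_epsilon; intros e He; rewrite Rplus_0_l.
  (* three sides of length at most d / 2^n, on which |w - p| <= 5 d / 2^n *)
  set (eps := e / (15 * d * d + 1)).
  assert (Hden : 0 < 15 * d * d + 1) by nra.
  assert (Heps : 0 < eps) by (apply Rdiv_lt_0_compat; lra).
  destruct (Hl eps Heps) as [delta [Hdelta Hlin]].
  destruct (dyadic_small (5 * d) delta ltac:(lra) Hdelta) as [n Hn].
  assert (H2 : 0 < 2 ^ n) by (apply pow_lt; lra).
  set (rho := d / 2 ^ n) in *.
  assert (Hrho : 5 * rho < delta).
  { replace (5 * rho) with (5 * d / 2 ^ n) by (unfold rho; field; lra); exact Hn. }
  assert (Hrho0 : 0 <= rho) by (apply Rle_div_r; lra).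
  destruct (tD n) as (Da & Db & Dc).
  destruct (tS n) as (Sa & Sb & Sc); fold rho in Sa, Sb, Sc.
  assert (Na4 : Cmod (va (t n) - p) <= 4 * rho).
  { replace (4 * rho) with (4 * d / 2 ^ n) by (unfold rho; field; lra); apply Hp. }
  assert (Na : Cmod (va (t n) - p) <= 5 * rho) by lra.
  assert (Nb : Cmod (vb (t n) - p) <= 5 * rho).
  { eapply Rle_trans; [apply (Cmod_sub_triangle _ (va (t n)))|]; lra. }
  assert (Nc : Cmod (vc (t n) - p) <= 5 * rho).
  { eapply Rle_trans; [apply (Cmod_sub_triangle _ (va (t n)))|].
    rewrite (Cmod_sub_sym (vc (t n))); lra. }
  (* E is the error of the linear approximation of H at p *)
  set (lin := (fun w => (H p - p * l) + l * w)%C).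
  set (E := (fun w => (-(1)) * lin w + H w)%C).
  assert (linh : forall w, holo lin w).
  { intros w; apply holo_plus; [apply holo_const | apply holo_mult; [apply holo_const | apply holo_id]]. }
  assert (Eh : forall w, D w -> holo E w).
  { intros w Hw; apply holo_plus; [|apply Hh, Hw].
    apply holo_mult; [apply holo_const | apply linh]. }
  assert (Eb : forall u v, D u -> D v -> Cmod (u - p) <= 5 * rho -> Cmod (v - p) <= 5 * rho ->
     Cmod (v - u) <= rho -> Cmod (seg_int E u v) <= eps * (5 * rho * rho)).
  { intros u v Du Dv Nu Nv Suv.
    apply Rle_trans with (Cmod (v - u) * (eps * (5 * rho))).
    - apply seg_int_bound; [apply (inD_seg_cont D); assumption|].
      intros s Hs.
      assert (Nw := path_near u v p (5 * rho) s Nu Nv Hs).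
      replace (E (path u v s)) with (H (path u v s) - H p - (path u v s - p) * l)%C
        by (unfold E, lin; ring).
      eapply Rle_trans; [apply Hlin; lra|].
      apply Rmult_le_compat_l; lra.
    - replace (eps * (5 * rho * rho)) with (rho * (eps * (5 * rho))) by ring.
      apply Rmult_le_compat_r; [|exact Suv]. nra. }
  assert (TE : triangle_int H (t n) = triangle_int E (t n)).
  { unfold triangle_int, tri_int, E.
    assert (SL : forall u v, D u -> D v -> seg_int (fun w => (-(1)) * lin w + H w)%C u v =
       ((-(1)) * seg_int lin u v + seg_int H u v)%C).
    { intros u v Du Dv; apply seg_int_linear; [|apply (inD_seg_cont D); assumption].
      apply holo_seg_cont; intros; apply linh. }
    rewrite !SL by assumption; unfold lin; rewrite !seg_int_affine.
    field. }
  specialize (tB n); rewrite TE in tB.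
  assert (B : Cmod (triangle_int E (t n)) <= 15 * eps * (rho * rho)).
  { unfold triangle_int, tri_int.
    eapply Rle_trans; [apply Cmod_triangle|].
    assert (TT := Cmod_triangle (seg_int E (va (t n)) (vb (t n))) (seg_int E (vb (t n)) (vc (t n)))).
    assert (E1 := Eb _ _ Da Db Na Nb Sa); assert (E2 := Eb _ _ Db Dc Nb Nc Sb);
    assert (E3 := Eb _ _ Dc Da Nc Na Sc); lra. }
  apply Rle_trans with (15 * eps * (d * d)).
  - eapply Rle_trans; [exact tB|].
    replace (15 * eps * (d * d)) with (4 ^ n * (15 * eps * (rho * rho))).
    + apply Rmult_le_compat_l; [apply pow_le; lra | exact B].
    + replace 4 with (2 * 2) by ring; rewrite Rpow_mult_distr; unfold rho; field; lra.
  - unfold eps. replace (15 * (e / (15 * d * d + 1)) * (d * d))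
      with (e * (15 * d * d / (15 * d * d + 1))) by (field; lra).
    rewrite <- (Rmult_1_r e) at 2; apply Rmult_le_compat_l; [lra|].
    apply Rle_div_l; lra.
Qed.

(** * Isolated singularities and the Cauchy formula for triangles *)

(** The determinant of u and v, that is Im (Cconj u * v): it is positive when v lies
    to the left of u. *)
Definition cross (u v : C) : R := fst u * snd v - snd u * fst v.

Lemma half_plane_convex_closed (a b c : R) :
  convex_closed (fun w => c <= a * fst w + b * snd w).
Proof.
  split.
  - intros p q t Hp Hq Ht; unfold path; simpl; nra.
  - apply (closed_comp (T := C_UniformSpace) (U := R_UniformSpace)
      (fun w : C => a * fst w + b * snd w) (fun x => c <= x)); [|apply closed_ge].
    intros w; apply (continuous_plus (U := C_UniformSpace) (V := R_NormedModule));
      apply (continuous_scal_r (U := C_UniformSpace) (V := R_NormedModule));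
      [apply continuous_fst | apply continuous_snd].
Qed.

Definition homothety (z : C) (e : R) (p : C) : C := (z + RtoC e * (p - z))%C.

(** cross (w - z) (q - p) is constant along the line from p to q, equal to its
    value cross (p - z) (q - z) at the end point p. *)
Lemma path_off_center (z p q : C) t : 0 < cross (p - z) (q - z) -> path p q t <> z.
Proof.
  intros Hc E.
  assert (K : cross (path p q t - z) (q - p) = cross (p - z) (q - z))
    by (unfold cross, path; simpl; ring).
  rewrite <- K, E in Hc; unfold cross in Hc; simpl in Hc; lra.
Qed.

Lemma homothety_1 z p : homothety z 1 p = p.
Proof. unfold homothety; ring. Qed.

Lemma homothety_off_center (z p : C) e : 0 < e -> p <> z -> homothety z e p <> z.
Proof.
  intros He Hp E.
  apply (Cmult_neq_0 (RtoC e) (p - z)).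
  - intros E0; apply RtoC_inj in E0; lra.
  - intros E0; apply Hp, Ceq_minus, E0.
  - replace (RtoC e * (p - z))%C with (homothety z e p - z)%C by (unfold homothety; ring).
    rewrite E; ring.
Qed.

Lemma homothety_path z e p q t :
  path (homothety z e p) (homothety z e q) t = homothety z e (path p q t).
Proof. unfold homothety, path; ring. Qed.

Lemma spoke z e p t : path p (homothety z e p) t = homothety z (1 - t + t * e) p.
Proof. unfold homothety, path; rewrite RtoC_plus, RtoC_minus, RtoC_mult; ring. Qed.

(** The trapezoid between the segment [p, q] and its homothetic image lies in
    a half-plane that excludes z, where Goursat's theorem applies to the two
    triangles that compose it. *)
Lemma frustum H z p q e : (forall w, w <> z -> holo H w) ->
  0 < cross (p - z) (q - z) -> 0 < e <= 1 ->
  (seg_int H p q + seg_int H q (homothety z e q) + seg_int H (homothety z e q) (homothety z e p)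
   + seg_int H (homothety z e p) p = 0)%C.
Proof.
  intros Hh Hc He.
  set (kap := cross (p - z) (q - z)) in *.
  set (A := snd (q - p)%C); set (B := (- fst (q - p)%C)%R).
  (* cross (w - z) (q - p) equals kap on [p, q], e * kap on the image of [p, q], and 0 at z *)
  set (D := fun w : C => e * kap + A * fst z + B * snd z <= A * fst w + B * snd w).
  assert (HD : convex_closed D) by apply half_plane_convex_closed.
  assert (Dh : forall w, D w -> holo H w).
  { intros w Hw; apply Hh; intros ->; unfold D in Hw; nra. }
  assert (Dp : forall s, e <= s -> D (homothety z s p)).
  { intros s Hs. assert (e * kap <= s * kap) by nra.
    revert H0; unfold D, kap, cross, A, B, homothety; simpl; nra. }
  assert (Dq : forall s, e <= s -> D (homothety z s q)).
  { intros s Hs. assert (e * kap <= s * kap) by nra.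
    revert H0; unfold D, kap, cross, A, B, homothety; simpl; nra. }
  assert (D1 := Dp 1 ltac:(lra)); rewrite homothety_1 in D1.
  assert (D2 := Dq 1 ltac:(lra)); rewrite homothety_1 in D2.
  assert (D3 := Dp e ltac:(lra)); assert (D4 := Dq e ltac:(lra)).
  assert (G1 := Goursat D H _ _ _ HD Dh D1 D2 D4).
  assert (G2 := Goursat D H _ _ _ HD Dh D1 D4 D3).
  unfold tri_int in G1, G2.
  rewrite (seg_int_rev H p (homothety z e q)) in G1 by (apply (inD_seg_cont D); assumption).
  rewrite <- (Cplus_0_l 0), <- G1 at 1; rewrite <- G2; ring.
Qed.

(** The triangle p, q, r is positively oriented and z is interior to it. *)
Definition inside (z p q r : C) : Prop :=
  0 < cross (p - z) (q - z) /\ 0 < cross (q - z) (r - z) /\ 0 < cross (r - z) (p - z).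

(** Summing [frustum] over the three sides, the contributions of the spokes from
    each vertex to its image cancel. *)
Lemma tri_int_shrink H z p q r e : (forall w, w <> z -> holo H w) ->
  inside z p q r -> 0 < e <= 1 ->
  tri_int H p q r = tri_int H (homothety z e p) (homothety z e q) (homothety z e r).
Proof.
  intros Hh (I1 & I2 & I3) He.
  assert (F1 := frustum H z p q e Hh I1 He).
  assert (F2 := frustum H z q r e Hh I2 He).
  assert (F3 := frustum H z r p e Hh I3 He).
  assert (S1 : forall p q, 0 < cross (p - z) (q - z) ->
     seg_int H (homothety z e p) p = (- seg_int H p (homothety z e p))%C).
  { intros u v Huv; apply seg_int_rev, holo_seg_cont; intros t Ht; apply Hh.
    rewrite spoke; apply homothety_off_center; [nra|].
    replace u with (path u v 0) by (unfold path; ring); apply path_off_center, Huv. }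
  assert (S2 : forall p q, 0 < cross (p - z) (q - z) ->
     seg_int H (homothety z e q) (homothety z e p) = (- seg_int H (homothety z e p) (homothety z e q))%C).
  { intros u v Huv; apply seg_int_rev, holo_seg_cont; intros t Ht; apply Hh.
    rewrite homothety_path; apply homothety_off_center; [lra | apply path_off_center, Huv]. }
  rewrite (S1 _ _ I1), (S2 _ _ I1) in F1.
  rewrite (S1 _ _ I2), (S2 _ _ I2) in F2.
  rewrite (S1 _ _ I3), (S2 _ _ I3) in F3.
  apply Ceq_minus; rewrite <- (Cplus_0_l 0), <- (Cplus_0_l 0), <- F1 at 1; rewrite <- F2 at 1; rewrite <- F3.
  unfold tri_int; ring.
Qed.

(** The integral over the homothetic triangle of ratio e is at most a constant
    times e M, and it does not depend on e. *)
Lemma tri_int_removable H z p q r M delta : (forall w, w <> z -> holo H w) ->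
  inside z p q r -> 0 < delta ->
  (forall w, w <> z -> Cmod (w - z) < delta -> Cmod (H w) <= M) ->
  tri_int H p q r = RtoC 0.
Proof.
  intros Hh I Hdelta HM.
  set (rad := Cmod (p - z) + Cmod (q - z) + Cmod (r - z)).
  assert (Hp := Cmod_ge_0 (p - z)); assert (Hq := Cmod_ge_0 (q - z)); assert (Hr := Cmod_ge_0 (r - z)).
  assert (Bd : forall e u v, 0 < e <= 1 -> 0 < cross (u - z) (v - z) ->
     Cmod (u - z) <= rad -> Cmod (v - z) <= rad -> e * rad < delta ->
     Cmod (seg_int H (homothety z e u) (homothety z e v)) <= e * (2 * rad * M)).
  { intros e u v He Hc Hu Hv Hs.
    assert (Hoff : forall t, path (homothety z e u) (homothety z e v) t <> z).
    { intros t; rewrite homothety_path; apply homothety_off_center; [lra | apply path_off_center, Hc]. }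
    assert (Hn : forall t, 0 <= t <= 1 -> Cmod (path (homothety z e u) (homothety z e v) t - z) < delta).
    { intros t Ht; rewrite homothety_path.
      replace (homothety z e (path u v t) - z)%C
        with (RtoC e * (path u v t - z))%C by (unfold homothety; ring).
      assert (N := path_near u v z rad t Hu Hv Ht).
      rewrite Cmod_mult, Cmod_R, Rabs_pos_eq by lra; nra. }
    assert (M0 : 0 <= M).
    { eapply Rle_trans; [apply Cmod_ge_0|]; apply (HM (path (homothety z e u) (homothety z e v) 0)).
      - apply Hoff.
      - apply Hn; lra. }
    eapply Rle_trans.
    - apply seg_int_bound with (M := M).
      + apply holo_seg_cont; intros t Ht; apply Hh, Hoff.
      + intros t Ht; apply HM; [apply Hoff | apply Hn, Ht].
    - replace (homothety z e v - homothety z e u)%C with (RtoC e * (v - u))%C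
        by (unfold homothety; ring).
      rewrite Cmod_mult, Cmod_R, Rabs_pos_eq by lra.
      assert (T := Cmod_sub_triangle v z u); rewrite (Cmod_sub_sym z u) in T.
      rewrite Rmult_assoc; apply Rmult_le_compat_l; [lra|].
      apply Rmult_le_compat_r; lra. }
  apply Cmod_eq_0, Rle_antisym; [|apply Cmod_ge_0].
  apply le_epsilon; intros eta Heta; rewrite Rplus_0_l.
  set (e := Rmin 1 (Rmin (delta / (2 * (rad + 1))) (eta / (6 * (rad + 1) * (Rabs M + 1))))).
  assert (Hrad : 0 <= rad) by (unfold rad; lra).
  assert (HMa := Rabs_pos M); assert (HMb := Rle_abs M).
  assert (He : 0 < e).
  { repeat apply Rmin_pos; [lra| |]; apply Rdiv_lt_0_compat; try lra.
    apply Rmult_lt_0_compat; lra. }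
  assert (He1 : e <= 1) by apply Rmin_l.
  assert (He2 : e <= delta / (2 * (rad + 1))) by (eapply Rle_trans; [apply Rmin_r | apply Rmin_l]).
  assert (He3 : e <= eta / (6 * (rad + 1) * (Rabs M + 1))) by (eapply Rle_trans; [apply Rmin_r | apply Rmin_r]).
  apply Rle_div_r in He2; [|lra].
  apply Rle_div_r in He3; [|apply Rlt_gt, Rmult_lt_0_compat; lra].
  assert (Hs : e * rad < delta) by nra.
  rewrite (tri_int_shrink H z p q r e Hh I ltac:(lra)).
  destruct I as (I1 & I2 & I3).
  assert (B1 := Bd e p q ltac:(lra) I1 ltac:(unfold rad; lra) ltac:(unfold rad; lra) Hs).
  assert (B2 := Bd e q r ltac:(lra) I2 ltac:(unfold rad; lra) ltac:(unfold rad; lra) Hs).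
  assert (B3 := Bd e r p ltac:(lra) I3 ltac:(unfold rad; lra) ltac:(unfold rad; lra) Hs).
  unfold tri_int; eapply Rle_trans; [apply Cmod_triangle|].
  eapply Rle_trans; [apply Rplus_le_compat_r, Cmod_triangle|].
  apply Rle_trans with (e * (6 * rad * M)); [lra|].
  eapply Rle_trans; [|exact He3]; apply Rmult_le_compat_l; [lra|]. nra.
Qed.

Definition on_tri (p q r w : C) : Prop :=
  exists t, 0 <= t <= 1 /\ (w = path p q t \/ w = path q r t \/ w = path r p t).

Lemma on_tri_seg_cont H p q r : (forall w, on_tri p q r w -> holo H w) ->
  seg_cont H p q /\ seg_cont H q r /\ seg_cont H r p.
Proof.
  intros Hh; repeat split; apply holo_seg_cont; intros t Ht; apply Hh; exists t; tauto.
Qed.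

Lemma tri_int_linear c H G p q r : (forall w, on_tri p q r w -> holo H w) ->
  (forall w, on_tri p q r w -> holo G w) ->
  tri_int (fun w => c * H w + G w)%C p q r = (c * tri_int H p q r + tri_int G p q r)%C.
Proof.
  intros HH HG; apply on_tri_seg_cont in HH; apply on_tri_seg_cont in HG.
  unfold tri_int; rewrite !seg_int_linear by tauto; ring.
Qed.

Lemma tri_int_ext H G p q r : (forall w, on_tri p q r w -> H w = G w) ->
  tri_int H p q r = tri_int G p q r.
Proof.
  intros E; unfold tri_int; f_equal; [f_equal|]; apply seg_int_ext; intros t Ht; apply E; exists t;
    (split; [lra | tauto]).
Qed.

Lemma tri_int_bound H p q r M : (forall w, on_tri p q r w -> holo H w) ->
  (forall w, on_tri p q r w -> Cmod (H w) <= M) ->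
  Cmod (tri_int H p q r) <= (Cmod (q - p) + Cmod (r - q) + Cmod (p - r)) * M.
Proof.
  intros HH HM; apply on_tri_seg_cont in HH; destruct HH as (H1 & H2 & H3).
  assert (B1 := seg_int_bound H p q M H1 ltac:(intros t Ht; apply HM; exists t; tauto)).
  assert (B2 := seg_int_bound H q r M H2 ltac:(intros t Ht; apply HM; exists t; tauto)).
  assert (B3 := seg_int_bound H r p M H3 ltac:(intros t Ht; apply HM; exists t; tauto)).
  unfold tri_int; eapply Rle_trans; [apply Cmod_triangle|].
  eapply Rle_trans; [apply Rplus_le_compat_r, Cmod_triangle|]; lra.
Qed.

Lemma inside_off z p q r w : inside z p q r -> on_tri p q r w -> w <> z.
Proof.
  intros (I1 & I2 & I3) (t & Ht & [->|[->| ->]]); apply path_off_center; assumption.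
Qed.

Lemma holo_Cauchy_kernel z w : w <> z -> holo (fun w => / (w - z))%C w.
Proof.
  intros Hw; apply (holo_comp Cinv (fun w => w - z)%C).
  - apply holo_inv; intros E; apply Hw, Ceq_minus, E.
  - apply holo_minus; [apply holo_id | apply holo_const].
Qed.

(** The difference quotient (F w - F z) / (w - z) is bounded near z because F is
    differentiable there, so it integrates to zero. *)
Lemma Cauchy_formula F z p q r : (forall w, holo F w) -> inside z p q r ->
  tri_int (fun w => F w * / (w - z))%C p q r = (F z * tri_int (fun w => / (w - z))%C p q r)%C.
Proof.
  intros HF I.
  assert (K : forall w, on_tri p q r w -> holo (fun w => / (w - z))%C w).
  { intros w Hw; apply holo_Cauchy_kernel, (inside_off z p q r w I Hw). }
  destruct (proj1 (holo_deriv_at F z) (HF z)) as [l Hl].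
  destruct (Hl 1 Rlt_0_1) as [delta [Hdelta Hlin]].
  assert (T0 : tri_int (fun w => (F w - F z) * / (w - z))%C p q r = RtoC 0).
  { apply (tri_int_removable _ z p q r (1 + Cmod l) delta); trivial.
    - intros w Hw; apply holo_mult; [apply holo_minus; [apply HF | apply holo_const] |].
      apply holo_Cauchy_kernel, Hw.
    - intros w Hw Hd; specialize (Hlin w Hd).
      assert (Hwz : (w - z)%C <> RtoC 0) by (intros E; apply Hw, Ceq_minus, E).
      assert (Hm : 0 < Cmod (w - z)) by (apply Cmod_gt_0, Hwz).
      rewrite Cmod_mult, Cmod_inv by exact Hwz.
      apply Rle_div_l; [exact Hm|].
      replace (F w - F z)%C with ((F w - F z - (w - z) * l) + (w - z) * l)%C by ring.
      eapply Rle_trans; [apply Cmod_triangle|]; rewrite Cmod_mult; lra. }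
  rewrite (tri_int_ext _ (fun w => (- F z) * / (w - z) + F w * / (w - z))%C) in T0 by (intros; ring).
  rewrite tri_int_linear in T0.
  - apply Ceq_minus; rewrite <- T0; ring.
  - exact K.
  - intros w Hw; apply holo_mult; [apply HF | apply K, Hw].
Qed.

(** dw / (w - z) has imaginary part the variation of the argument, which is
    positive when z is on the left of the segment: with w on the segment from p to
    q, Im ((q - p) / (w - z)) = cross (w - z) (q - p) / |w - z|^2, and
    the numerator is the constant cross (p - z) (q - z). *)
Lemma seg_int_Cauchy_kernel_Im z p q : 0 < cross (p - z) (q - z) ->
  0 < snd (seg_int (fun w => / (w - z))%C p q).
Proof.
  intros Hc.
  assert (Hoff : forall t, path p q t <> z).
  { intros t; apply path_off_center, Hc. }
  assert (K1 : seg_cont (fun w => / (w - z))%C p q).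
  { apply holo_seg_cont; intros t Ht; apply holo_Cauchy_kernel, Hoff. }
  assert (K2 : seg_cont (fun w => (q - p) * / (w - z))%C p q).
  { apply holo_seg_cont; intros t Ht; apply holo_mult; [apply holo_const | apply holo_Cauchy_kernel, Hoff]. }
  assert (I := proj2 (proj1 (C_is_RInt_pair _ _ _ _)
    (is_RInt_Cmult (q - p)%C _ _ _ _ (seg_int_correct _ _ _ K1)))).
  apply (is_RInt_unique (V := R_CompleteNormedModule)) in I; unfold seg_int; rewrite <- I.
  apply RInt_gt_0; [lra | |].
  - intros t Ht.
    assert (Hm : 0 < Cmod (path p q t - z)).
    { apply Cmod_gt_0; intros E; apply (Hoff t), Ceq_minus, E. }
    set (u := (path p q t - z)%C) in *.
    assert (Hu : 0 < fst u ^ 2 + snd u ^ 2).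
    { rewrite <- (pow2_sqrt (fst u ^ 2 + snd u ^ 2)) by nra. apply pow_lt, Hm. }
    replace (snd ((q - p) * / u)%C) with (cross u (q - p) / (fst u ^ 2 + snd u ^ 2))
      by (unfold cross, Cinv; simpl; field; simpl in Hu; lra).
    apply Rdiv_lt_0_compat; [|exact Hu].
    replace (cross u (q - p)) with (cross (p - z) (q - z)); [exact Hc|].
    unfold u, cross, path; simpl; ring.
  - intros t Ht.
    apply (continuous_comp (V := C_UniformSpace) (fun s => ((q - p) * / (path p q s - z))%C) snd).
    + apply K2, Ht.
    + apply continuous_snd.
Qed.

Lemma tri_int_Cauchy_kernel_nz z p q r : inside z p q r ->
  tri_int (fun w => / (w - z))%C p q r <> RtoC 0.
Proof.
  intros (I1 & I2 & I3) E; apply (f_equal snd) in E; revert E; unfold tri_int; simpl.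
  apply seg_int_Cauchy_kernel_Im in I1, I2, I3; simpl in *; lra.
Qed.

Lemma on_tri_bounded F p q r : (forall w, holo F w) ->
  exists M, 0 <= M /\ forall w, on_tri p q r w -> Cmod (F w) <= M.
Proof.
  intros HF.
  assert (B : forall u v, exists M, forall t, 0 <= t <= 1 -> Cmod (F (path u v t)) <= M).
  { intros u v.
    destruct (bounded_continuity (V := C_R_NormedModule) (fun t => F (path u v t)) 0 1) as [M HM].
    - apply holo_seg_cont; intros; apply HF.
    - exists M; intros t Ht; specialize (HM t Ht); rewrite norm_C_R in HM; lra. }
  destruct (B p q) as [M1 H1]; destruct (B q r) as [M2 H2]; destruct (B r p) as [M3 H3].
  exists (Rmax 0 (Rmax M1 (Rmax M2 M3))); split; [apply Rmax_l|].
  intros w (t & Ht & [->|[->| ->]]).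
  - eapply Rle_trans; [apply H1, Ht|]. eapply Rle_trans; [|apply Rmax_r]; apply Rmax_l.
  - eapply Rle_trans; [apply H2, Ht|]. do 2 (eapply Rle_trans; [|apply Rmax_r]); apply Rmax_l.
  - eapply Rle_trans; [apply H3, Ht|]. do 3 (eapply Rle_trans; [|apply Rmax_r]); apply Rle_refl.
Qed.

(** * Taylor remainders and the identity theorem *)

(** These three vertices span a right triangle that contains the disc of radius r. *)
Lemma inside_big_triangle z r : Cmod z < r ->
  inside z (- r, - r) (3 * r, - r) (- r, 3 * r).
Proof.
  intros Hz.
  assert (H1 := fst_le_Cmod z); assert (H2 := snd_le_Cmod z).
  apply Rabs_le_between in H1; apply Rabs_le_between in H2.
  assert (H0 := Cmod_ge_0 z).
  destruct z as [x y]; unfold inside, cross; simpl in *.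
  repeat split; nra.
Qed.

Lemma big_triangle_far r w : 0 < r ->
  on_tri (- r, - r) (3 * r, - r) (- r, 3 * r) w -> r <= Cmod w.
Proof.
  intros Hr (t & Ht & [->|[->| ->]]).
  - eapply Rle_trans; [|apply snd_le_Cmod]; unfold path; simpl.
    rewrite <- Rabs_Ropp; eapply Rle_trans; [|apply Rle_abs]; nra.
  (* the hypotenuse lies on x + y = 2 r *)
  - assert (S : fst (path (3 * r, - r) (- r, 3 * r) t) + snd (path (3 * r, - r) (- r, 3 * r) t) = 2 * r)
      by (unfold path; simpl; ring).
    assert (A := fst_le_Cmod (path (3 * r, - r) (- r, 3 * r) t)).
    assert (B := snd_le_Cmod (path (3 * r, - r) (- r, 3 * r) t)).
    apply Rabs_le_between in A; apply Rabs_le_between in B; lra.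
  - eapply Rle_trans; [|apply fst_le_Cmod]; unfold path; simpl.
    rewrite <- Rabs_Ropp; eapply Rle_trans; [|apply Rle_abs]; nra.
Qed.

Section TaylorRemainder.
Variables (F : C -> C) (r : R).
Hypothesis (HF : forall w, holo F w) (Hr : 0 < r).

Let p1 : C := (- r, - r).
Let p2 : C := (3 * r, - r).
Let p3 : C := (- r, 3 * r).

(** The quotient by z^N of the N-th Taylor remainder of F at 0, so that its
    value at 0 is the N-th Taylor coefficient, both up to the factor
    int dw/(w - z) of the Cauchy formula. *)
Definition remainder (N : nat) (z : C) : C :=
  tri_int (fun w => F w * (/ w ^ N * / (w - z)))%C p1 p2 p3.

Lemma on_big_nz z w : Cmod z < r -> on_tri p1 p2 p3 w -> (w - z)%C <> RtoC 0 /\ w <> RtoC 0.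
Proof.
  intros Hz Hw; apply big_triangle_far in Hw; [|exact Hr]; split; intros E.
  - apply Ceq_minus in E; subst; lra.
  - subst w; rewrite Cmod_0 in Hw; lra.
Qed.

Lemma remainder_holo N z w : Cmod z < r -> on_tri p1 p2 p3 w ->
  holo (fun w => F w * (/ w ^ N * / (w - z)))%C w.
Proof.
  intros Hz Hw; destruct (on_big_nz z w Hz Hw) as [H1 H2].
  apply holo_mult; [apply HF | apply holo_mult].
  - apply (holo_comp Cinv (fun w => w ^ N)%C); [apply holo_inv, Cpow_nz, H2 | apply holo_pow, holo_id].
  - apply holo_Cauchy_kernel; intros E; apply H1, (proj1 (Ceq_minus w z)), E.
Qed.

(** Integrated form of
    1 / (w^N (w - z)) = 1 / w^(N+1) + z / (w^(N+1) (w - z)). *)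
Lemma remainder_step N z : Cmod z < r ->
  remainder N z = (remainder N 0 + z * remainder (S N) z)%C.
Proof.
  intros Hz.
  assert (H0 : Cmod 0 < r) by (rewrite Cmod_0; exact Hr).
  rewrite Cplus_comm; unfold remainder; rewrite <- tri_int_linear.
  - apply tri_int_ext; intros w Hw; destruct (on_big_nz z w Hz Hw) as [H1 H2].
    assert (H3 := Cpow_nz w N H2).
    simpl; field; repeat split; trivial.
  - intros w; apply remainder_holo, Hz.
  - intros w; apply remainder_holo, H0.
Qed.

Lemma remainder_bound : exists K, 0 <= K /\ forall N z, Cmod z <= r / 2 ->
  Cmod (remainder N z) <= K / r ^ N.
Proof.
  destruct (on_tri_bounded F p1 p2 p3 HF) as (M & HM0 & HM).
  set (per := Cmod (p2 - p1) + Cmod (p3 - p2) + Cmod (p1 - p3)).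
  assert (Hper : 0 <= per).
  { unfold per; generalize (Cmod_ge_0 (p2 - p1)) (Cmod_ge_0 (p3 - p2)) (Cmod_ge_0 (p1 - p3)); lra. }
  exists (per * (M * (2 / r))); split.
  { apply Rmult_le_pos; [exact Hper|]; apply Rmult_le_pos; [exact HM0|].
    apply Rlt_le, Rdiv_lt_0_compat; lra. }
  intros N z Hz.
  assert (Hz' : Cmod z < r) by lra.
  assert (HrN : 0 < r ^ N) by (apply pow_lt, Hr).
  replace (per * (M * (2 / r)) / r ^ N) with (per * (M * (/ r ^ N * / (r / 2)))) by (field; lra).
  apply tri_int_bound; [intros w; apply remainder_holo, Hz'|].
  intros w Hw; destruct (on_big_nz z w Hz' Hw) as [H1 H2].
  assert (Hfar := big_triangle_far r w Hr Hw).
  assert (HwN := Cpow_nz w N H2).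
  rewrite !Cmod_mult, !Cmod_inv, Cmod_pow by assumption.
  assert (Hwz : r / 2 <= Cmod (w - z)).
  { assert (T := Cmod_sub_triangle w z 0).
    replace (w - 0)%C with w in T by ring; replace (z - 0)%C with z in T by ring; lra. }
  assert (0 < Cmod w) by lra.
  assert (Hp : r ^ N <= Cmod w ^ N) by (apply pow_incr; lra).
  apply Rmult_le_compat; [apply Cmod_ge_0 | | apply HM, Hw |].
  - apply Rmult_le_pos; apply Rlt_le, Rinv_0_lt_compat; lra.
  - apply Rmult_le_compat; try (apply Rlt_le, Rinv_0_lt_compat; lra); apply Rinv_le_contravar; lra.
Qed.

Lemma remainder_0_Cauchy z : Cmod z < r ->
  remainder 0 z = (F z * tri_int (fun w => / (w - z))%C p1 p2 p3)%C.
Proof.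
  intros Hz; rewrite <- Cauchy_formula; [|exact HF | apply inside_big_triangle, Hz].
  apply tri_int_ext; intros w Hw; destruct (on_big_nz z w Hz Hw) as [H1 H2]; simpl; field; trivial.
Qed.

Hypothesis zeros : forall eps, 0 < eps -> exists z, 0 < Cmod z < eps /\ F z = RtoC 0.

(** Along the zeros z of F, remainder N z = 0 gives remainder N 0 =
    - z * remainder (S N) z, which is O(|z|): the N-th coefficient vanishes, and then
    so does remainder (S N) at each of these zeros. *)
Lemma remainder_zeros N :
  remainder N 0 = RtoC 0 /\
  forall z, Cmod z <= r / 2 -> z <> RtoC 0 -> F z = RtoC 0 -> remainder (S N) z = RtoC 0.
Proof.
  assert (Step : forall N, (forall z, Cmod z <= r / 2 -> z <> RtoC 0 -> F z = RtoC 0 -> remainder N z = RtoC 0) ->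
    remainder N 0 = RtoC 0 /\
    forall z, Cmod z <= r / 2 -> z <> RtoC 0 -> F z = RtoC 0 -> remainder (S N) z = RtoC 0).
  { clear N; intros N HN.
    destruct remainder_bound as (K & HK0 & HK).
    assert (Z : remainder N 0 = RtoC 0).
    { apply Cmod_eq_0, Rle_antisym; [|apply Cmod_ge_0].
      apply le_epsilon; intros e He; rewrite Rplus_0_l.
      assert (HrN : 0 < r ^ S N) by (apply pow_lt, Hr).
      assert (HKN : 0 <= K / r ^ S N) by (apply Rle_div_r; lra).
      destruct (zeros (Rmin (r / 2) (e / (K / r ^ S N + 1)))) as (z & Hz & Fz).
      { apply Rmin_pos; [lra | apply Rdiv_lt_0_compat; lra]. }
      assert (Hz1 : Cmod z < r / 2) by (eapply Rlt_le_trans; [apply Hz | apply Rmin_l]).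
      assert (Hz2 : Cmod z < e / (K / r ^ S N + 1)) by (eapply Rlt_le_trans; [apply Hz | apply Rmin_r]).
      assert (St := remainder_step N z ltac:(lra)).
      rewrite (HN z ltac:(lra) (proj2 (Cmod_gt_0 z) (proj1 Hz)) Fz) in St.
      replace (remainder N 0) with (- (z * remainder (S N) z))%C.
      - rewrite Cmod_opp, Cmod_mult.
        specialize (HK (S N) z ltac:(lra)). apply Rlt_div_r in Hz2; [|lra].
        apply Rle_trans with (Cmod z * (K / r ^ S N)); [apply Rmult_le_compat_l; lra | lra].
      - apply Ceq_minus.
        transitivity (- (remainder N 0 + z * remainder (S N) z))%C; [ring | rewrite <- St; ring]. }
    split; [exact Z|].
    intros z Hz Hz0 Fz.
    assert (St := remainder_step N z ltac:(lra)).
    rewrite (HN z Hz Hz0 Fz), Z, Cplus_0_l in St.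
    destruct (Ceq_dec (remainder (S N) z) 0) as [E|E]; [exact E|].
    exfalso; apply (Cmult_neq_0 _ _ Hz0 E); symmetry; exact St. }
  induction N as [|N IH]; apply Step; [|apply IH].
  intros z Hz Hz0 Fz; rewrite remainder_0_Cauchy by lra; rewrite Fz; ring.
Qed.

(** All coefficients being zero, remainder 0 z = z^N * remainder N z, which is
    at most K (|z| / r)^N. *)
Lemma zero_near_origin z : Cmod z < r / 2 -> F z = RtoC 0.
Proof.
  intros Hz.
  destruct remainder_bound as (K & HK0 & HK).
  assert (P : forall N, remainder 0 z = (z ^ N * remainder N z)%C).
  { intros N; induction N as [|N IH]; [simpl; ring|].
    rewrite IH, (remainder_step N z) by lra.
    rewrite (proj1 (remainder_zeros N)); simpl; ring. }
  assert (Z : remainder 0 z = RtoC 0).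
  { apply Cmod_eq_0, Rle_antisym; [|apply Cmod_ge_0].
    apply le_epsilon; intros e He; rewrite Rplus_0_l.
    destruct (dyadic_small K e HK0 He) as [N HN].
    rewrite (P N), Cmod_mult, Cmod_pow.
    assert (HrN : 0 < r ^ N) by (apply pow_lt, Hr).
    apply Rle_trans with ((r / 2) ^ N * (K / r ^ N)).
    - apply Rmult_le_compat; [apply pow_le, Cmod_ge_0 | apply Cmod_ge_0 | | apply HK; lra].
      apply pow_incr; split; [apply Cmod_ge_0 | lra].
    - replace ((r / 2) ^ N * (K / r ^ N)) with (K / 2 ^ N); [lra|].
      unfold Rdiv; rewrite Rpow_mult_distr, pow_inv; field; split; [lra | apply pow_nonzero; lra]. }
  rewrite remainder_0_Cauchy in Z by lra.
  destruct (Ceq_dec (F z) 0) as [E|E]; [exact E|].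
  exfalso; revert Z; apply Cmult_neq_0; [exact E|].
  apply tri_int_Cauchy_kernel_nz, inside_big_triangle; lra.
Qed.
End TaylorRemainder.

(** The radius 2 |z - p| + 1 is chosen so that z lies in the half disc. *)
Lemma identity_theorem F p : entire F ->
  (forall eps, 0 < eps -> exists z, 0 < Cmod (z - p) < eps /\ F z = RtoC 0) ->
  forall z, F z = RtoC 0.
Proof.
  intros HF Hz z.
  assert (Hr := Cmod_ge_0 (z - p)).
  replace z with (p + (z - p))%C by ring.
  apply (zero_near_origin (fun w => F (p + w)%C) (2 * Cmod (z - p) + 1)); try lra.
  - intros w; apply (holo_comp F (fun w => p + w)%C); [apply HF|].
    apply holo_plus; [apply holo_const | apply holo_id].
  - intros eps He; destruct (Hz eps He) as (u & Hu & Fu).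
    exists (u - p)%C; split; [exact Hu|].
    replace (p + (u - p))%C with u by ring; exact Fu.
Qed.

(** * Reflection in horizontal lines and periods of the quotient *)

Lemma vanish_on_line F (p d : C) : entire F -> d <> RtoC 0 ->
  (forall t : R, F (p + RtoC t * d)%C = RtoC 0) -> forall z, F z = RtoC 0.
Proof.
  intros HF Hd Ht; apply (identity_theorem F p HF); intros eps He.
  assert (Hm : 0 < Cmod d) by (apply Cmod_gt_0, Hd).
  exists (p + RtoC (eps / 2 / Cmod d) * d)%C; split; [|apply Ht].
  replace (p + RtoC (eps / 2 / Cmod d) * d - p)%C with (RtoC (eps / 2 / Cmod d) * d)%C by ring.
  assert (0 < eps / 2 / Cmod d) by (apply Rdiv_lt_0_compat; lra).
  rewrite Cmod_mult, Cmod_R, Rabs_pos_eq by lra.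
  replace (eps / 2 / Cmod d * Cmod d) with (eps / 2) by (field; lra); lra.
Qed.

(** G has no zero near x0, so F vanishes near x0. *)
Lemma entire_cancel F G x0 : entire F -> entire G -> G x0 <> RtoC 0 ->
  (forall z, (F z * G z)%C = RtoC 0) -> forall z, F z = RtoC 0.
Proof.
  intros HF HG Hx HFG; apply (identity_theorem F x0 HF); intros eps He.
  assert (Hm : 0 < Cmod (G x0)) by (apply Cmod_gt_0, Hx).
  destruct (proj1 (holo_deriv_at G x0) (HG x0)) as [l Hl].
  destruct (Hl 1 Rlt_0_1) as (delta & Hdelta & Hlin).
  assert (Hl0 := Cmod_ge_0 l).
  set (s := Rmin (eps / 2) (Rmin (delta / 2) (Cmod (G x0) / (2 * (1 + Cmod l))))).
  assert (Hs0 : 0 < s) by (repeat apply Rmin_pos; try apply Rdiv_lt_0_compat; lra).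
  assert (Hs1 : s <= eps / 2) by apply Rmin_l.
  assert (Hs2 : s <= delta / 2) by (eapply Rle_trans; [apply Rmin_r | apply Rmin_l]).
  assert (Hs3 : s <= Cmod (G x0) / (2 * (1 + Cmod l))) by (eapply Rle_trans; [apply Rmin_r | apply Rmin_r]).
  apply Rle_div_r in Hs3; [|lra].
  assert (Hsm : Cmod (x0 + RtoC s - x0) = s).
  { replace (x0 + RtoC s - x0)%C with (RtoC s) by ring; rewrite Cmod_R; apply Rabs_pos_eq; lra. }
  exists (x0 + RtoC s)%C; split; [lra|].
  destruct (Ceq_dec (F (x0 + RtoC s)%C) 0) as [E|E]; [exact E|exfalso].
  apply (Cmult_neq_0 _ (G (x0 + RtoC s)%C) E); [|apply HFG].
  intros E2; specialize (Hlin (x0 + RtoC s)%C ltac:(lra)); rewrite E2, Hsm in Hlin.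
  assert (T := Cmod_triangle (0 - G x0 - (x0 + RtoC s - x0) * l) ((x0 + RtoC s - x0) * l)).
  replace (0 - G x0 - (x0 + RtoC s - x0) * l + (x0 + RtoC s - x0) * l)%C with (- G x0)%C in T by ring.
  rewrite Cmod_opp, Cmod_mult, Hsm in T. nra.
Qed.

Definition reflected (f : C -> C) (z : C) : C := Cconj (f (Cconj z)).

Lemma reflected_entire f : entire f -> entire (reflected f).
Proof.
  intros Hf z; apply holo_deriv_at.
  destruct (proj1 (holo_deriv_at f (Cconj z)) (Hf (Cconj z))) as [l Hl].
  exists (Cconj l); intros eps He; destruct (Hl eps He) as (delta & Hd & H).
  exists delta; split; [exact Hd|]; intros w Hw; unfold reflected.
  assert (Hwz : Cmod (Cconj w - Cconj z) = Cmod (w - z)) by (rewrite <- Cminus_conj; apply Cmod_conj).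
  rewrite <- Hwz in Hw |- *; specialize (H _ Hw).
  rewrite <- Cmod_conj, !Cminus_conj, Cmult_conj, Cminus_conj, !Cconj_conj in H; exact H.
Qed.

Lemma entire_shift f c : entire f -> entire (fun z => f (z + c)%C).
Proof.
  intros Hf z; apply (holo_comp f (fun z => z + c)%C); [apply Hf|].
  apply holo_plus; [apply holo_id | apply holo_const].
Qed.

(** On the line Im z = c the point z - 2ic is Cconj z, and both products are squared
    moduli; the identity extends to the plane because both sides are entire. *)
Lemma equal_modulus_reflection f g c : entire f -> entire g ->
  (forall x : R, Cmod (f (x, c)) = Cmod (g (x, c))) ->
  forall z, (f z * reflected f (z - Ci * RtoC (2 * c)) = g z * reflected g (z - Ci * RtoC (2 * c)))%C.
Proof.
  intros Hf Hg Hfg z; apply Ceq_minus; revert z.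
  apply (vanish_on_line _ (0, c) 1).
  - assert (K : forall h, entire h -> entire (fun z => h z * reflected h (z - Ci * RtoC (2 * c)))%C).
    { intros h Hh z; apply holo_mult; [apply Hh|].
      apply (entire_shift (reflected h) (- (Ci * RtoC (2 * c)))%C), reflected_entire, Hh. }
    intros z; apply holo_minus; apply K; assumption.
  - apply C1_nz.
  - intros t.
    replace ((0, c) + RtoC t * 1)%C with ((t, c) : C) by (unfold Cplus, Cmult; simpl; f_equal; ring).
    unfold reflected.
    replace (Cconj ((t, c) - Ci * RtoC (2 * c))) with ((t, c) : C)
      by (unfold Cconj, Cminus, Cplus, Copp, Cmult, Ci; simpl; f_equal; ring).
    rewrite <- !Cmod2_conj, Hfg; ring.
Qed.

(** i p is a period of the meromorphic function f / g, written without
    denominators. *)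
Definition ratio_period (f g : C -> C) (p : R) : Prop :=
  forall z, (f z * g (z + Ci * RtoC p) = g z * f (z + Ci * RtoC p))%C.

(** In terms of h = f / g and of its reflection h*, the two lines give
    h(z) h*(z) = 1 = h(z) h*(z - 2ic), so h* has the period 2ic, and so has h. *)
Lemma ratio_period_of_lines f g c x0 : entire f -> entire g -> g x0 <> RtoC 0 ->
  (forall x : R, Cmod (f (x, 0)) = Cmod (g (x, 0))) ->
  (forall x : R, Cmod (f (x, c)) = Cmod (g (x, c))) ->
  ratio_period f g (2 * c).
Proof.
  intros Hf Hg Hx H0 Hc.
  assert (E0 := equal_modulus_reflection f g 0 Hf Hg H0).
  assert (Ec := equal_modulus_reflection f g c Hf Hg Hc).
  assert (Rf := reflected_entire f Hf); assert (Rg := reflected_entire g Hg).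
  set (s := (- (Ci * RtoC (2 * c)))%C).
  assert (E : forall z, (reflected f z * reflected g (z + s) - reflected g z * reflected f (z + s))%C = RtoC 0).
  { apply (entire_cancel _ g x0); trivial.
    - intros z; apply holo_minus; apply holo_mult; try apply Rf; try apply Rg;
      [apply (entire_shift (reflected g)) | apply (entire_shift (reflected f))]; assumption.
    - intros z; specialize (E0 z); specialize (Ec z).
      replace (z - Ci * RtoC (2 * 0))%C with z in E0 by (rewrite Rmult_0_r; ring).
      change (z - Ci * RtoC (2 * c))%C with (z + s)%C in Ec.
      transitivity (reflected f z * (g z * reflected g (z + s)) - (g z * reflected g z) * reflected f (z + s))%C;
        [ring | rewrite <- Ec, <- E0; ring]. }
  intros z; specialize (E (Cconj z)); apply Ceq_minus in E.
  unfold reflected in E; rewrite !Cconj_conj in E.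
  replace (Cconj (Cconj z + s)) with (z + Ci * RtoC (2 * c))%C in E.
  - apply (f_equal Cconj) in E; rewrite !Cmult_conj, !Cconj_conj in E; exact E.
  - rewrite Cplus_conj, Cconj_conj; f_equal; unfold s, Cconj, Copp, Cmult, Ci; simpl; f_equal; ring.
Qed.

(** Both relations are read at the common point z + i p, whose value of g is then
    cancelled. *)
Lemma ratio_period_minus f g x0 p q : entire f -> entire g -> g x0 <> RtoC 0 ->
  ratio_period f g p -> ratio_period f g q -> ratio_period f g (p - q).
Proof.
  intros Hf Hg Hx Hp Hq z; apply Ceq_minus; revert z.
  apply (entire_cancel _ (fun z => g (z + Ci * RtoC p)%C) (x0 - Ci * RtoC p)%C).
  - intros z; apply holo_minus; apply holo_mult; try apply Hf; try apply Hg;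
      [apply (entire_shift g) | apply (entire_shift f)]; assumption.
  - apply entire_shift, Hg.
  - replace (x0 - Ci * RtoC p + Ci * RtoC p)%C with x0 by ring; exact Hx.
  - intros z; specialize (Hp z); specialize (Hq (z + Ci * RtoC (p - q))%C).
    replace (z + Ci * RtoC (p - q) + Ci * RtoC q)%C with (z + Ci * RtoC p)%C in Hq
      by (rewrite RtoC_minus; ring).
    transitivity ((f z * g (z + Ci * RtoC p)) * g (z + Ci * RtoC (p - q))
      - g z * (f (z + Ci * RtoC (p - q)) * g (z + Ci * RtoC p)))%C; [ring|].
    rewrite Hp, Hq; ring.
Qed.

(** Euclid's algorithm by subtraction: each step removes at least delta from
    x + y, so it must end with two equal numbers. *)
Lemma discrete_group_commensurable (P : R -> Prop) delta :
  (forall x y, P x -> P y -> P (x - y)) -> 0 < delta ->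
  (forall x, P x -> 0 < x -> delta <= x) ->
  forall N x y, P x -> P y -> 0 < x -> 0 < y -> x + y < INR N * delta ->
  exists m n : Z, (0 < m)%Z /\ (0 < n)%Z /\ IZR m * x = IZR n * y.
Proof.
  intros Hsub Hd Hdisc; induction N as [|N IH]; intros x y Px Py Hx Hy Hxy; [simpl in Hxy; lra|].
  rewrite S_INR in Hxy.
  assert (Dx := Hdisc x Px Hx); assert (Dy := Hdisc y Py Hy).
  destruct (Rtotal_order x y) as [L|[L|L]].
  - destruct (IH x (y - x) Px (Hsub y x Py Px) Hx ltac:(lra) ltac:(lra)) as (m & n & Hm & Hn & E).
    exists (m + n)%Z, n; repeat split; [lia | lia | rewrite plus_IZR; lra].
  - exists 1%Z, 1%Z; repeat split; try lia; subst; reflexivity.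
  - destruct (IH (x - y) y (Hsub x y Px Py) Py ltac:(lra) Hy ltac:(lra)) as (m & n & Hm & Hn & E).
    exists m, (m + n)%Z; repeat split; [lia | lia | rewrite plus_IZR; lra].
Qed.

Lemma small_elements (P : R -> Prop) x y :
  (forall x y, P x -> P y -> P (x - y)) -> P x -> P y -> 0 < x -> 0 < y ->
  irrational (y / x) -> forall eps, 0 < eps -> exists p, P p /\ 0 < p < eps.
Proof.
  intros Hsub Px Py Hx Hy Hirr eps He; apply NNPP; intros Hn; apply Hirr.
  destruct (INR_unbounded ((x + y) / eps)) as [N HN].
  apply Rlt_gt, Rlt_div_l in HN; [|exact He].
  destruct (discrete_group_commensurable P eps Hsub He) with (N := N) (x := x) (y := y)
    as (m & n & Hm & Hn' & E); trivial.
  - intros p Pp Hp; apply Rnot_lt_le; intros Hlt; apply Hn; exists p; split; [exact Pp | lra].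
  - exists (m # Z.to_pos n); unfold Q2R; simpl; rewrite Z2Pos.id by exact Hn'.
    apply (IZR_lt 0) in Hn'. apply (Rmult_eq_reg_r x); [|lra].
    unfold Rdiv; rewrite Rmult_assoc, Rinv_l, Rmult_1_r by lra.
    rewrite (Rmult_comm (IZR m)), Rmult_assoc, E; field; lra.
Qed.

Lemma unit_cis (c : C) : Cmod c = 1 -> exists alpha, c = cis alpha.
Proof.
  intros Hc.
  assert (Hs : fst c ^ 2 + snd c ^ 2 = 1).
  { rewrite <- (pow2_sqrt (fst c ^ 2 + snd c ^ 2)) by nra.
    change (Cmod c ^ 2 = 1); rewrite Hc; ring. }
  destruct c as [x y]; simpl in Hs.
  assert (Hx : -1 <= x <= 1) by nra.
  assert (Hy : sin (acos x) = Rabs y).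
  { rewrite sin_acos by exact Hx; replace (1 - x²) with (y²) by (unfold Rsqr; lra).
    apply sqrt_Rsqr_abs. }
  destruct (Rle_dec 0 y) as [P|P].
  (* the sign of y decides between the two angles of cosine x *)
  - exists (acos x); unfold cis; rewrite cos_acos, Hy, Rabs_pos_eq by assumption; reflexivity.
  - exists (- acos x); unfold cis; rewrite cos_neg, sin_neg, cos_acos, Hy, Rabs_left by lra.
    f_equal; ring.
Qed.

Lemma Cmod_cis alpha : Cmod (cis alpha) = 1.
Proof.
  unfold Cmod, cis; simpl.
  replace (cos alpha * (cos alpha * 1) + sin alpha * (sin alpha * 1)) with 1; [apply sqrt_1|].
  assert (H := sin2_cos2 alpha); unfold Rsqr in H; lra.
Qed.

(** The base point x0 is taken on the real line, so that c = f(x0)/g(x0) has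
    modulus 1 at once; for a small period p, the relation at x0 says that
    x0 + i p is a zero of f(x0) g - g(x0) f. *)
Lemma uniqueness_horizontal f g A B : entire f -> entire g -> A <> 0 -> B <> 0 ->
  irrational (Rabs B / Rabs A) ->
  (forall x : R, Cmod (f (x, 0)) = Cmod (g (x, 0))) ->
  (forall x : R, Cmod (f (x, A)) = Cmod (g (x, A))) ->
  (forall x : R, Cmod (f (x, B)) = Cmod (g (x, B))) ->
  eq_up_to_phase f g.
Proof.
  intros Hf Hg HA HB Hirr H0 H1 H2.
  destruct (classic (exists x0 : R, g (x0, 0) <> RtoC 0)) as [[x0 Hx0]|Hall].
  (* if g vanishes on the real line then so does f, and both are zero *)
  2:{ assert (Z : forall h, entire h -> (forall x : R, h (x, 0) = RtoC 0) -> forall z, h z = RtoC 0).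
      { intros h Hh Hz; apply (vanish_on_line h 0 1 Hh C1_nz); intros t.
        transitivity (h (t, 0)); [|apply Hz]; f_equal.
        unfold RtoC, Cplus, Cmult; simpl; f_equal; ring. }
      assert (Hg0 : forall x : R, g (x, 0) = RtoC 0).
      { intros x; apply NNPP; intros N; apply Hall; exists x; exact N. }
      exists 0; intros z; rewrite (Z g Hg Hg0 z), (Z f Hf); [symmetry; apply Cmult_0_r|].
      intros x; apply Cmod_eq_0; rewrite H0, Hg0; apply Cmod_0. }
  assert (Hsub := fun p q => ratio_period_minus f g (x0, 0) p q Hf Hg Hx0).
  assert (Habs : forall c, ratio_period f g (2 * c) -> ratio_period f g (2 * Rabs c)).
  { intros c Hc; unfold Rabs; destruct Rcase_abs; [|exact Hc].
    (* - 2c = (2c - 2c) - 2c uses differences only *)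
    replace (2 * - c) with (2 * c - 2 * c - 2 * c) by ring; auto. }
  assert (PA := Habs A (ratio_period_of_lines f g A _ Hf Hg Hx0 H0 H1)).
  assert (PB := Habs B (ratio_period_of_lines f g B _ Hf Hg Hx0 H0 H2)).
  apply Rabs_pos_lt in HA, HB.
  assert (small := small_elements (ratio_period f g) _ _ Hsub PA PB ltac:(lra) ltac:(lra)
    ltac:(replace (2 * Rabs B / (2 * Rabs A)) with (Rabs B / Rabs A) by (field; lra); exact Hirr)).
  assert (E : forall w, (f (x0, 0%R) * g w - g (x0, 0%R) * f w)%C = RtoC 0).
  { apply (identity_theorem _ (x0, 0)).
    - intros w; apply holo_minus; apply holo_mult; try apply holo_const; [apply Hg | apply Hf].
    - intros eps He; destruct (small eps He) as (p & Pp & Hp).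
      exists ((x0, 0) + Ci * RtoC p)%C; split.
      + replace ((x0, 0) + Ci * RtoC p - (x0, 0))%C with (Ci * RtoC p)%C by ring.
        rewrite Cmod_mult, Cmod_Ci, Cmod_R, Rabs_pos_eq; lra.
      + rewrite Pp; ring. }
  destruct (unit_cis (f (x0, 0) / g (x0, 0))%C) as [alpha Halpha].
  { rewrite Cmod_div, H0 by exact Hx0; field; apply Rgt_not_eq, Cmod_gt_0, Hx0. }
  exists alpha; intros z; rewrite <- Halpha.
  specialize (E z); apply Ceq_minus in E.
  transitivity ((g (x0, 0%R) * f z) / g (x0, 0%R))%C; [field; exact Hx0|].
  rewrite <- E; field; exact Hx0.
Qed.

(** Each pair of parallel lines comes with its own common direction; this makes
    one direction serve for all three. *)
Lemma is_line_direction d d' L M : is_line d L -> is_line d' L -> is_line d' M -> is_line d M.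
Proof.
  intros [Hd [p Hp]] [Hd' [p' Hp']] [_ [m Hm]].
  destruct (proj1 (Hp p')) as [t0 E0].
  { apply Hp'; exists 0; ring. }
  destruct (proj1 (Hp (p' + d')%C)) as [t1 E1].
  { apply Hp'; exists 1; ring. }
  assert (E : d' = (RtoC (t1 - t0) * d)%C).
  { replace d' with ((p' + d') - p')%C by ring; rewrite E1, E0, RtoC_minus; ring. }
  assert (Hl : t1 - t0 <> 0).
  { intros Z; apply Hd'; rewrite E, Z; ring. }
  split; [exact Hd|]; exists m; intros z; rewrite Hm; split; intros [t ->].
  - exists (t * (t1 - t0)); rewrite E, RtoC_mult; ring.
  - exists (t / (t1 - t0)); rewrite E, Cmult_assoc, <- RtoC_mult; do 3 f_equal; field; exact Hl.
Qed.

(** After division by d both lines are horizontal, and the infimum is attained at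
    points with the same real part. *)
Lemma set_dist_lines d p q L M : d <> RtoC 0 ->
  (forall z, L z <-> exists t : R, z = (p + RtoC t * d)%C) ->
  (forall z, M z <-> exists t : R, z = (q + RtoC t * d)%C) ->
  set_dist L M = Finite (Rabs (snd ((p - q) / d)%C) * Cmod d).
Proof.
  intros Hd HL HM; apply is_glb_Rbar_unique.
  assert (Key : forall t s : R, Cmod (p + RtoC t * d - (q + RtoC s * d)) =
     Cmod ((p - q) / d + RtoC (t - s)) * Cmod d).
  { intros t s; rewrite <- Cmod_mult; f_equal; rewrite RtoC_minus; field; exact Hd. }
  set (u := ((p - q) / d)%C) in *.
  split.
  - intros x (z & w & Lz & Mw & ->).
    apply HL in Lz; apply HM in Mw; destruct Lz as [t ->], Mw as [s ->].
    simpl; rewrite Key; apply Rmult_le_compat_r; [apply Cmod_ge_0|].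
    eapply Rle_trans; [|apply snd_le_Cmod]; right; f_equal; simpl; ring.
  - intros b Hb; apply Hb.
    exists (p + RtoC (- fst u) * d)%C, (q + RtoC 0 * d)%C.
    repeat split; [apply HL; eexists; reflexivity | apply HM; eexists; reflexivity |].
    rewrite Key; f_equal.
    replace (u + RtoC (- fst u - 0))%C with (Ci * RtoC (snd u))%C
      by (destruct u; unfold Ci, RtoC, Cplus, Cmult; simpl; f_equal; ring).
    rewrite Cmod_mult, Cmod_Ci, Cmod_R; ring.
Qed.

Lemma on_parallel_line (p q d : C) (x : R) : d <> RtoC 0 ->
  exists t : R, (q + d * (x, snd ((p - q) / d)%C) = p + RtoC t * d)%C.
Proof.
  intros Hd; set (u := ((p - q) / d)%C).
  exists (x - fst u).
  replace p with (q + u * d)%C by (unfold u; field; exact Hd).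
  replace ((x, snd u) : C) with (u + RtoC (x - fst u))%C
    by (destruct u; unfold RtoC, Cplus; simpl; f_equal; ring).
  ring.
Qed.

Theorem theorem1 :
  forall (L1 L2 L3 : C -> Prop) (a b : R) (f g : C -> C),
    parallel L1 L2 -> parallel L2 L3 -> parallel L1 L3 ->
    0 < a -> set_dist L1 L2 = Finite a ->
    0 < b -> set_dist L2 L3 = Finite b ->
    irrational (b / a) ->
    entire f -> entire g ->
    ((forall z : C, L1 z \/ L2 z \/ L3 z -> Cmod (f z) = Cmod (g z))
     <-> eq_up_to_phase f g).
Proof.
  intros L1 L2 L3 a b f g [d [Hl1 Hl2]] [d' [Hl2' Hl3']] _ Ha Da Hb Db Hirr Hf Hg.
  split.
  2:{ intros [alpha E] z _; rewrite E, Cmod_mult, Cmod_cis; ring. }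
  intros Hmod.
  assert (Hl3 := is_line_direction d d' L2 L3 Hl2 Hl2' Hl3').
  destruct Hl1 as [Hd [p1 Hp1]], Hl2 as [_ [p2 Hp2]], Hl3 as [_ [p3 Hp3]].
  assert (Hm : 0 < Cmod d) by (apply Cmod_gt_0, Hd).
  rewrite (set_dist_lines d p1 p2 L1 L2 Hd Hp1 Hp2) in Da.
  rewrite (set_dist_lines d p2 p3 L2 L3 Hd Hp2 Hp3) in Db.
  set (A := snd ((p1 - p2) / d)%C) in *.
  set (B := snd ((p3 - p2) / d)%C).
  replace (Rabs (snd ((p2 - p3) / d)%C)) with (Rabs B) in Db.
  2:{ rewrite <- Rabs_Ropp; f_equal; unfold B.
      replace ((p2 - p3) / d)%C with (- ((p3 - p2) / d))%C by (field; exact Hd); reflexivity. }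
  injection Da as Da; injection Db as Db.
  destruct (uniqueness_horizontal (fun w => f (p2 + d * w)%C) (fun w => g (p2 + d * w)%C) A B)
    as [alpha Halpha].
  - intros w; apply (holo_comp f (fun w => p2 + d * w)%C); [apply Hf|].
    apply holo_plus; [apply holo_const | apply holo_mult; [apply holo_const | apply holo_id]].
  - intros w; apply (holo_comp g (fun w => p2 + d * w)%C); [apply Hg|].
    apply holo_plus; [apply holo_const | apply holo_mult; [apply holo_const | apply holo_id]].
  - intros Z; rewrite Z, Rabs_R0 in Da; lra.
  - intros Z; rewrite Z, Rabs_R0 in Db; lra.
  - replace (Rabs B / Rabs A) with (b / a); [exact Hirr|].
    assert (HA : Rabs A <> 0) by (intros Z; rewrite Z in Da; lra).
    rewrite <- Da, <- Db; field; lra.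
  - intros x; apply Hmod; right; left; apply Hp2; exists x.
    f_equal; rewrite Cmult_comm; reflexivity.
  - intros x; apply Hmod; left; apply Hp1, (on_parallel_line p1 p2 d x Hd).
  - intros x; apply Hmod; right; right; apply Hp3, (on_parallel_line p3 p2 d x Hd).
  - exists alpha; intros z; specialize (Halpha ((z - p2) / d)%C).
    replace (p2 + d * ((z - p2) / d))%C with z in Halpha by (field; exact Hd).
    exact Halpha.
Qed.
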